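(* Let $(X,d)$ be an Hadamard space, let $f,g: X\to\overline{\mathbb{R}}$ be proper, convex and lower semicontinuous functions, let $\gamma>0$, and define $$\Phi(x,y) := f(x)+g(y)+\frac{1}{2\gamma}d(x,y)^2\qquad (x,y\in X).$$ Assume that $\Phi$ is bounded below on $X^2$. Let $(x_n)_{n\ge 0}$ and $(y_n)_{n\ge 0}$ be sequences in $X$ satisfying $$\sum_{n=0}^\infty d\left(y_n,\operatorname{Prox}_{\gamma g}(x_n)\right)<+\infty\qquad\text{and}\qquad \sum_{n=0}^\infty d\left(x_{n+1},\operatorname{Prox}_{\gamma f}(y_n)\right)<+\infty.$$ Then the following hold: (a) $\displaystyle\sum_{n=0}^\infty d(x_{n+1},x_n)^2<+\infty$ and $\displaystyle\sum_{n=0}^\infty d(y_{n+1},y_n)^2<+\infty$. If, moreover, there exists a minimizer of $\Phi$ over $X^2$, then: (b) $$\inf\{\Phi(x,y) \mid x,y\in X\}=\lim_{n\to\infty}\Phi\left(\operatorname{Prox}_{\gamma f}(\operatorname{Prox}_{\gamma g}(x_n)),\operatorname{Prox}_{\gamma g}(x_n)\right)=\lim_{n\to\infty}\Phi\left(\operatorname{Prox}_{\gamma f}(y_n),\operatorname{Prox}_{\gamma g}(\operatorname{Prox}_{\gamma f}(y_n))\right);$$ (c) the sequence $((x_n,y_n))_{n\ge 0}$ converges weakly in $X^2$ to a minimizer of $\Phi$ over $X^2$; (d) if one of the functions $f$ and $g$ is uniformly convex, then $((x_n,y_n))_{n\ge 0}$ converges, with respect to the metric, to the unique minimizer of $\Phi$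 over $X^2$.
   Context: An Hadamard space is a complete metric space $(X,d)$ such that for any $x,y\in X$ there is a point $m\in X$ with $d(z,m)^2\le\frac12 d(z,x)^2+\frac12 d(z,y)^2-\frac14 d(x,y)^2$ for all $z\in X$ (a complete CAT(0) space). For any $x,y\in X$ there is then a unique map $\gamma_{x,y}:[0,1]\to X$ (the geodesic joining $x$ and $y$) with $d(z,\gamma_{x,y}(\lambda))^2\le(1-\lambda)d(z,x)^2+\lambda d(z,y)^2-\lambda(1-\lambda)d(x,y)^2$ for all $z\in X$, $\lambda\in[0,1]$; it satisfies $\gamma_{x,y}(0)=x$, $\gamma_{x,y}(1)=y$ and $d(\gamma_{x,y}(\lambda_1),\gamma_{x,y}(\lambda_2))=|\lambda_1-\lambda_2|d(x,y)$. The geodesic segment is $[x,y]:=\{\gamma_{x,y}(\lambda)\mid 0\le\lambda\le1\}$. (The number $\gamma>0$ in the claim is unrelated to the geodesics $\gamma_{x,y}$.) $X^2=X\times X$ is an Hadamard space with the metric $d((x_1,y_1),(x_2,y_2))^2=d(x_1,x_2)^2+d(y_1,y_2)^2$ and componentwise geodesics. $\overline{\mathbb{R}}=\mathbb{R}\cup\{\pm\infty\}$. A function $f:X\to\overline{\mathbb{R}}$ is proper if it is not constantly $+\infty$ and never takes the value $-\infty$; it is convex if $f(\gamma_{x,y}(\lambda))\le(1-\lambda)f(x)+\lambda f(y)$ for all $x,y\in X$, $\lambda\in[0,1]$. It is uniformly convex if there is a nondecreasing function $\phi:[0,+\infty)\to[0,+\infty]$ with $\phi(t)=0\iff t=0$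 such that $f(\gamma_{x,y}(\lambda))\le(1-\lambda)f(x)+\lambda f(y)-\lambda(1-\lambda)\phi(d(x,y))$ for all $x,y\in X$, $\lambda\in[0,1]$ (conventions: $0\cdot(+\infty)=0$, and there is no condition when $f(x)=+\infty$ or $f(y)=+\infty$). For a proper, convex, lower semicontinuous $h:X\to\overline{\mathbb{R}}$ and $x\in X$, $\operatorname{Prox}_h(x)$ denotes the unique minimizer of $y\mapsto h(y)+\frac12 d(x,y)^2$ over $X$ (existence and uniqueness are known). For a nonempty closed convex set $C$ (convex: containing the geodesic between any two of its points), $\operatorname{Proj}_C(x)$ is the unique minimizer of $y\mapsto d(x,y)^2$ over $y\in C$. A sequence $(x_n)_{n\ge0}$ in an Hadamard space $X$ converges weakly to $x\in X$ if $\operatorname{Proj}_{[x,y]}(x_n)\to x$ for every $y\in X$. *)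

(* Defs.v *)
From HB Require Import structures.
From mathcomp Require Import all_boot all_order all_algebra.
From mathcomp Require Import all_classical all_reals all_analysis.
From mathcomp Require Import ring lra.

Set Implicit Arguments.
Unset Strict Implicit.
Unset Printing Implicit Defensive.

Import Order.TTheory GRing.Theory Num.Theory.
Import numFieldNormedType.Exports.

Local Open Scope classical_set_scope.
Local Open Scope ring_scope.

(* The library's complete spaces are pointed, so Hadamard spaces are nonempty
   here; the distinguished point is only the default value of [get] below. *)
HB.mixin Record Metric_isHadamard (R : realType) M & Metric R M := {
  mdist_midpoint : forall x y : M, exists m : M, forall z : M,
    mdist z m ^+ 2 <=
      2^-1 * mdist z x ^+ 2 + 2^-1 * mdist z y ^+ 2 - 4^-1 * mdist x y ^+ 2
}.

#[short(type="hadamardType")]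
HB.structure Definition Hadamard (R : realType) :=
  { M of Complete M & Metric R M & Metric_isHadamard R M }.

Section hadamard_notions.
Context {R : realType} {X : hadamardType R}.
Implicit Types (x y : X) (l : R) (C : set X) (f : X -> \bar R) (u : nat -> X).

Definition geodesic_point x y l : set X := [set p | forall z,
  mdist z p ^+ 2 <= (1 - l) * mdist z x ^+ 2 + l * mdist z y ^+ 2
                    - l * (1 - l) * mdist x y ^+ 2].

(* Meaningful for [0 <= l <= 1], see [geodesicP] and
   [geodesic_point_unique]. *)
Definition geodesic x y l : X := get (geodesic_point x y l).

Definition segment x y : set X := [set geodesic x y l | l in `[0, 1]].

Definition proper_fun f := (exists x, f x != +oo%E) /\ (forall x, f x != -oo%E).

(* [0 * +oo = 0] in [\bar R]. *)
Definition econvex f := forall x y l, 0 <= l <= 1 ->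
  (f (geodesic x y l) <= (1 - l)%:E * f x + l%:E * f y)%E.

(* The guards [f x < +oo] and [f y < +oo] matter: [+oo - +oo = -oo] in
   [\bar R]. *)
Definition uniformly_convex f := exists phi : R -> \bar R,
  [/\ forall t, 0 <= t -> (0 <= phi t)%E,
      forall s t, 0 <= s -> s <= t -> (phi s <= phi t)%E,
      forall t, 0 <= t -> (phi t = 0%E <-> t = 0) &
      forall x y l, 0 <= l <= 1 -> (f x < +oo)%E -> (f y < +oo)%E ->
        (f (geodesic x y l) <= (1 - l)%:E * f x + l%:E * f y
                               - (l * (1 - l))%:E * phi (mdist x y))%E].

Definition Proj C x : X :=
  get [set p | C p /\ forall q, C q -> mdist x p ^+ 2 <= mdist x q ^+ 2].

Definition weak_cvg u x :=
  forall y, (fun n => Proj (segment x y) (u n)) @ \oo --> x.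

End hadamard_notions.

Definition minimizers {R : realType} {T : Type} (F : T -> \bar R) : set T :=
  [set p | forall q, (F p <= F q)%E].

Definition Prox {R : realType} {X : hadamardType R} (h : X -> \bar R) (x : X)
    : X :=
  get (minimizers (fun y => h y + (2^-1 * mdist x y ^+ 2)%:E)%E).

Section geodesics.
Context {R : realType} {X : hadamardType R}.
Implicit Types (x y z p q : X) (l : R).

Lemma geodesic_point_unique x y l p q : 0 <= l <= 1 ->
  geodesic_point x y l p -> geodesic_point x y l q -> p = q.
Proof.
move=> /andP[l0 l1] hp hq; apply: mdist_positivity.
have := hp x; have := hp y; have := hq p.
rewrite !mdistxx (metric_sym p x) (metric_sym p y) (metric_sym y x).
move=> A B C; apply/eqP; rewrite -sqrf_eq0 eq_le sqr_ge0 andbT.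
apply: le_trans A _.
have := ler_wpM2l l0 B.
have l1' : 0 <= 1 - l by lra.
have := ler_wpM2l l1' C.
rewrite (metric_sym x p) (metric_sym y p).
by nra.
Qed.

Lemma geodesicP x y l : 0 <= l <= 1 -> geodesic_point x y l (geodesic x y l).
Proof.
move=> /andP[l0 l1]; apply: xgetPex.
have l1' : 0 <= 1 - l by lra.
pose F z := (1 - l) * mdist z x ^+ 2 + l * mdist z y ^+ 2.
have F0 z : 0 <= F z by rewrite addr_ge0// mulr_ge0// sqr_ge0.
have midF p q : exists m, mdist p m = mdist p q / 2 /\
    F m <= 2^-1 * F p + 2^-1 * F q - 4^-1 * mdist p q ^+ 2.
  have [m mP] := mdist_midpoint p q; exists m; split.
    have := mP p; have := mP q; have := metric_triangle p m q.
    rewrite !mdistxx (metric_sym m q) (metric_sym q p).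
    have := mdist_ge0 p m; have := mdist_ge0 q m; have := mdist_ge0 p q.
    move: (mdist p m) (mdist q m) (mdist p q) => a b c c0 b0 a0 abc B A.
    have {}A : a <= c / 2 by rewrite -ler_sqr ?nnegrE//; [nra|lra].
    have {}B : b <= c / 2 by rewrite -ler_sqr ?nnegrE//; [nra|lra].
    by lra.
  have := ler_wpM2l l1' (mP x); have := ler_wpM2l l0 (mP y).
  rewrite /F !(metric_sym x) !(metric_sym y).
  by nra.
pose I := inf (range F).
have hI : has_inf (range F).
  by split; [exists (F x), x|exists 0 => _ [z _ <-]].
have IF z : I <= F z by apply: ge_inf; [exact: hI.2|exists z].
pose S e := [set z | F z < I + e].
pose G := filter_from [set e : R | 0 < e] S.
have SG : ProperFilter G.
  apply: filter_from_proper; last first.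
    move=> e /= e0; have [_ [z _ <-] ze] := inf_adherent e0 hI.
    by exists z.
  apply: filter_from_filter; first by exists 1 => /=.
  move=> e1 e2 /= e10 e20; exists (Num.min e1 e2); first by rewrite lt_min e10.
  by move=> z; rewrite /S /= => h; split; apply: (lt_le_trans h);
    rewrite lerD2l ge_min lexx ?orbT.
have cG : cauchy G.
  apply/cauchy_ballP => e e0.
  exists (S (e ^+ 2 / 4), S (e ^+ 2 / 4)).
    by split; exists (e ^+ 2 / 4) => //=; rewrite divr_gt0// exprn_gt0.
  move=> [p q] [/= hp hq]; rewrite ballEmdist /=.
  have [m [_ hm]] := midF p q; have := IF m.
  rewrite -ltr_sqr ?nnegrE ?mdist_ge0 ?(ltW e0)//.
  by rewrite /S /= in hp hq; lra.
have /cvg_ex [p Gp] : cvg G by exact: cauchy_cvg.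
have Fp : F p <= I.
  apply/ler_addgt0Pl => e e0.
  pose C := (1 - l) * mdist p x + l * mdist p y.
  have C0 : 0 <= C by rewrite addr_ge0// mulr_ge0// mdist_ge0.
  pose D := 2 * C + 3.
  have D0 : 0 < D by rewrite /D; lra.
  pose d := Num.min 1 (e / 2 / D).
  have d0 : 0 < d by rewrite lt_min ltr01 !divr_gt0.
  have d1 : d <= 1 by rewrite ge_min lexx.
  have dD : d * D <= e / 2 by rewrite -ler_pdivlMr// ge_min lexx orbT.
  have Gb : G (ball p d) by apply: Gp; exact: nbhsx_ballx.
  have Ge : G (S (e / 2)) by exists (e / 2) => //=; rewrite divr_gt0.
  have [z [pz Sz]] := filter_ex (filterI Gb Ge).
  move: pz Sz; rewrite ballEmdist /S /= => pz Sz.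
  have k w : mdist p w ^+ 2 <= mdist z w ^+ 2 + d * (2 * mdist p w + 3).
    have := metric_triangle p z w; have := metric_triangle z p w.
    rewrite (metric_sym z p); have := mdist_ge0 z w; have := mdist_ge0 p w.
    move: (mdist p w) (mdist z w) (mdist p z) pz => a b c cd a0 b0 h1 h2.
    have : a ^+ 2 <= (b + d) ^+ 2 by rewrite ler_sqr ?nnegrE; lra.
    have : d * b <= d * (a + d) by rewrite ler_pM2l//; lra.
    have : d * d <= d * 1 by rewrite ler_pM2l.
    by nra.
  have := ler_wpM2l l1' (k x); have := ler_wpM2l l0 (k y).
  move: dD Sz; rewrite /D /C /F.
  by nra.
have key z n : F p + (1 - 2^-1 ^+ n) * mdist p z ^+ 2 <= F z.
  elim: n z => [|n IHn] z.
    by rewrite expr0 subrr mul0r addr0 (le_trans Fp).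
  have [m [pm hm]] := midF p z.
  have := IHn m; rewrite pm (exprS _ n) => IH.
  by move: (2^-1 ^+ n) IH hm => t; nra.
have var z : F p + mdist p z ^+ 2 <= F z.
  have H : (fun n => F p + (1 - 2^-1 ^+ n) * mdist p z ^+ 2)
      @ \oo --> F p + (1 - 0) * mdist p z ^+ 2.
    apply: cvgD; first exact: cvg_cst.
    apply: cvgMl.
    apply: cvgB; first exact: cvg_cst.
    by apply: cvg_expr; rewrite ger0_norm; lra.
  rewrite subr0 mul1r in H.
  rewrite -(cvg_lim _ H)//; apply: limr_le.
    by apply/cvg_ex; eexists; exact: H.
  by apply: nearW => n; exact: key.
exists p => z; have := var z.
have : l * (1 - l) * mdist x y ^+ 2 <= F p.
  have := metric_triangle x p y; rewrite (metric_sym x p) /F.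
  have := mdist_ge0 x y.
  move: (mdist p x) (mdist p y) (mdist x y) => a b c c0 abc.
  have : c ^+ 2 <= (a + b) ^+ 2 by rewrite ler_sqr ?nnegrE; lra.
  have := sqr_ge0 ((1 - l) * a - l * b).
  have : 0 <= l * (1 - l) by rewrite mulr_ge0.
  by nra.
by rewrite (metric_sym z p) /F; lra.
Qed.

End geodesics.

(* [X * Y] already carries the sup pseudometric of the library, hence an alias
   for the l2 metric. *)
Definition l2prod (X Y : Type) : Type := (X * Y)%type.

Section l2prod_metric.
Context {R : realType} {X Y : metricType R}.

HB.instance Definition _ := Choice.copy (l2prod X Y) (X * Y)%type.

Definition l2dist (p q : l2prod X Y) : R :=
  Num.sqrt (mdist p.1 q.1 ^+ 2 + mdist p.2 q.2 ^+ 2).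

Let sum2_ge0 (a b : R) : 0 <= a ^+ 2 + b ^+ 2.
Proof. by rewrite addr_ge0// sqr_ge0. Qed.

Let l2distxx p : l2dist p p = 0.
Proof. by rewrite /l2dist !mdistxx expr0n addr0 sqrtr0. Qed.

Let l2dist_eq0 p q : l2dist p q = 0 -> p = q.
Proof.
move/eqP; rewrite sqrtr_eq0 => h.
have := sqr_ge0 (mdist p.1 q.1); have := sqr_ge0 (mdist p.2 q.2) => a b.
have /eqP : mdist p.1 q.1 ^+ 2 = 0 by lra.
have /eqP : mdist p.2 q.2 ^+ 2 = 0 by lra.
rewrite !sqrf_eq0 => /eqP/mdist_positivity e2 /eqP/mdist_positivity e1.
by rewrite (surjective_pairing p) e1 e2 -surjective_pairing.
Qed.

Let l2dist_sym p q : l2dist p q = l2dist q p.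
Proof. by rewrite /l2dist (metric_sym p.1) (metric_sym p.2). Qed.

Let l2dist_triangle q p r : l2dist p r <= l2dist p q + l2dist q r.
Proof.
rewrite /l2dist; set u := mdist p.1 q.1; set v := mdist p.2 q.2.
set s := mdist q.1 r.1; set t := mdist q.2 r.2.
have u0 : 0 <= u := mdist_ge0 _ _; have v0 : 0 <= v := mdist_ge0 _ _.
have s0 : 0 <= s := mdist_ge0 _ _; have t0 : 0 <= t := mdist_ge0 _ _.
have h1 : mdist p.1 r.1 <= u + s := metric_triangle _ _ _.
have h2 : mdist p.2 r.2 <= v + t := metric_triangle _ _ _.
rewrite -ler_sqr ?nnegrE ?addr_ge0 ?sqrtr_ge0// sqrrD !sqr_sqrtr//.
have h3 : u * s + v * t <=
    Num.sqrt (u ^+ 2 + v ^+ 2) * Num.sqrt (s ^+ 2 + t ^+ 2).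
  rewrite -sqrtrM// -[leLHS]ger0_norm ?addr_ge0 ?mulr_ge0// -sqrtr_sqr.
  by rewrite ler_wsqrtr//; have := sqr_ge0 (u * t - v * s); nra.
have : mdist p.1 r.1 ^+ 2 <= (u + s) ^+ 2.
  by rewrite ler_sqr ?nnegrE ?mdist_ge0// addr_ge0.
have : mdist p.2 r.2 ^+ 2 <= (v + t) ^+ 2.
  by rewrite ler_sqr ?nnegrE ?mdist_ge0// addr_ge0.
by rewrite mulr2n; nra.
Qed.

HB.instance Definition _ :=
  isMetric.Build R (l2prod X Y) l2distxx l2dist_eq0 l2dist_sym l2dist_triangle.

Lemma l2distE (p q : l2prod X Y) :
  mdist p q ^+ 2 = mdist p.1 q.1 ^+ 2 + mdist p.2 q.2 ^+ 2.
Proof. by rewrite [mdist p q]/(l2dist p q) sqr_sqrtr. Qed.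

End l2prod_metric.

Section l2prod_hadamard.
Context {R : realType} {X Y : hadamardType R}.

HB.instance Definition _ := Pointed.copy (l2prod X Y) (X * Y)%type.

Let l2prod_complete (F : set_system (l2prod X Y)) :
  ProperFilter F -> cauchy F -> cvg F.
Proof.
move=> FF /cauchy_ballP cF.
have le1 (p q : l2prod X Y) : mdist p.1 q.1 <= mdist p q.
  by rewrite -ler_sqr ?nnegrE ?mdist_ge0// l2distE lerDl sqr_ge0.
have le2 (p q : l2prod X Y) : mdist p.2 q.2 <= mdist p q.
  by rewrite -ler_sqr ?nnegrE ?mdist_ge0// l2distE lerDr sqr_ge0.
have /cvg_ex [a aP] : cvg ((fst : l2prod X Y -> X) @ F).
  apply: cauchy_cvg; apply/cauchy_ballP => e e0.
  have [[A B] [FA FB] AB] := cF e e0.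
  exists (fst @` A, fst @` B).
    by split; [apply: filterS FA|apply: filterS FB] => z ?; exists z.
  move=> [_ _] [[p Ap <-] [q Bq <-]] /=; have := AB (p, q) (conj Ap Bq).
  by rewrite !ballEmdist /=; exact: le_lt_trans.
have /cvg_ex [b bP] : cvg ((snd : l2prod X Y -> Y) @ F).
  apply: cauchy_cvg; apply/cauchy_ballP => e e0.
  have [[A B] [FA FB] AB] := cF e e0.
  exists (snd @` A, snd @` B).
    by split; [apply: filterS FA|apply: filterS FB] => z ?; exists z.
  move=> [_ _] [[p Ap <-] [q Bq <-]] /=; have := AB (p, q) (conj Ap Bq).
  by rewrite !ballEmdist /=; exact: le_lt_trans.
suff Fab : F --> ((a, b) : l2prod X Y) by apply: (cvgP ((a, b) : l2prod X Y)).
apply/(@fcvg_ballP R (l2prod X Y) F _ (a, b)) => e e0.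
have e20 : 0 < e / 2 by rewrite divr_gt0.
have Fa : F [set p | ball a (e / 2) p.1] := aP _ (nbhsx_ballx a _ e20).
have Fb : F [set p | ball b (e / 2) p.2] := bP _ (nbhsx_ballx b _ e20).
apply: filterS (filterI Fa Fb) => p; rewrite /= !ballEmdist /= => -[h1 h2].
rewrite -ltr_sqr ?nnegrE ?mdist_ge0 ?(ltW e0)// l2distE /=.
have : mdist a p.1 ^+ 2 < (e / 2) ^+ 2
  by rewrite ltr_sqr ?nnegrE ?mdist_ge0 ?ltW.
have : mdist b p.2 ^+ 2 < (e / 2) ^+ 2
  by rewrite ltr_sqr ?nnegrE ?mdist_ge0 ?ltW.
by nra.
Qed.

HB.instance Definition _ :=
  Uniform_isComplete.Build (l2prod X Y) l2prod_complete.

Let l2prod_midpoint (p q : l2prod X Y) :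
  exists m : l2prod X Y, forall z : l2prod X Y,
  mdist z m ^+ 2 <=
    2^-1 * mdist z p ^+ 2 + 2^-1 * mdist z q ^+ 2 - 4^-1 * mdist p q ^+ 2.
Proof.
have [m1 h1] := mdist_midpoint p.1 q.1; have [m2 h2] := mdist_midpoint p.2 q.2.
exists (m1, m2) => z; have := h1 z.1; have := h2 z.2.
by rewrite !l2distE /=; lra.
Qed.

HB.instance Definition _ :=
  Metric_isHadamard.Build R (l2prod X Y) l2prod_midpoint.

Lemma l2prod_geodesic (p q : l2prod X Y) (l : R) : 0 <= l <= 1 ->
  geodesic p q l = (geodesic p.1 q.1 l, geodesic p.2 q.2 l).
Proof.
move=> l01; apply: (geodesic_point_unique l01); first exact: geodesicP.
move=> z; have := geodesicP p.1 q.1 l01 z.1; have := geodesicP p.2 q.2 l01 z.2.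
by rewrite !l2distE /=; lra.
Qed.

End l2prod_hadamard.

Definition objective {R : realType} {X : hadamardType R} (f g : X -> \bar R)
    (gam : R) (p : l2prod X X) : \bar R :=
  (f p.1 + g p.2 + ((2 * gam)^-1 * mdist p.1 p.2 ^+ 2)%:E)%E.

(* Main.v *)
Require Import Defs.
From mathcomp Require Import all_boot all_order all_algebra.
From mathcomp Require Import all_classical all_reals all_analysis.
From mathcomp Require Import ring lra.
Import Order.TTheory GRing.Theory Num.Theory.
Import numFieldNormedType.Exports.
Import metricType_numDomainType.

Set Implicit Arguments.
Unset Strict Implicit.
Unset Printing Implicit Defensive.

Local Open Scope classical_set_scope.
Local Open Scope ring_scope.

(** Put F = gam f, G = gam g, P = Prox_F, Q = Prox_G, and let
    psi(a, b) = F a + G b + d(a, b)^2 / 2 = gam Phi(a, b) be the joint energy.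
    A minimizer of psi is a pair with a = P b and b = Q a, and the sequences
    follow the alternation y_n = Q x_n, x_(n+1) = P y_n up to summable errors.

    Two facts drive the proof.  The first is the four-point inequality
      d(x,q)^2 + d(y,p)^2 <= d(x,p)^2 + d(y,q)^2 + 2 d(x,y) d(p,q)
    ([quadrilateral]), which replaces the expansion of scalar products.  The
    second is that Prox_F(x) minimizes a strongly convex function, so that
    every other point z pays an additional d(Prox_F x, z)^2 / 2
    ([prox_operator]).  Together they make the proximal maps nonexpansive.  The
    boundedness of Phi from below makes F and G bounded below by a multiple of
    minus a squared distance, which with convexity gives the existence of the
    proximal points ([Prox_operator]).

    Part (a).  Let v_n = Q x_n, u_n = P v_n and let eta_n be the error made
    between u_n and x_(n+1).  Comparing the proximal inequalities at steps n and
    n + 1, the four-point inequality leaves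
      psi(u_(n+1), v_(n+1)) + d(u_n, u_(n+1))^2 / 2
        <= psi(u_n, v_n) + eta_n d(x_(n+1), x_n),
    and the steps d(x_(n+1), x_n) are bounded because P Q is nonexpansive.
    Telescoping and the lower bound on psi give square summable steps
    ([alternation_sqr_steps]).

    Part (b).  For every pair (c, d),
      psi(P Q a, Q a) - psi(c, d) <= (d(a, c)^2 - d(P Q a, c)^2) / 2
    ([alternation_decrease]).  If (c, d) is a minimizer then d(x_n, c) decreases
    up to summable errors, hence converges, and the right-hand side at a = x_n
    tends to 0 ([alternation_energy_cvg]).

    Part (c).  The map (a, b) |-> (P b, Q a) of X^2 is nonexpansive, its fixed
    points are the minimizers, and (x_n, y_n) is an approximate fixed point
    sequence by (a), whose distances to the fixed points converge.  Such a
    sequence has a fixed point as its asymptotic center along every filter finer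
    than that of cofinite sets, always the same one ([opial]), and this implies
    weak convergence ([delta_cvg_weak]).

    Part (d).  If f is uniformly convex and u_n stays away from the first
    component of a minimizer, then the energy at the midpoint between (u_n, v_n)
    and this minimizer is below the average of the two energies by a fixed
    amount, against (b) ([uniformly_convex_alternation_cvg]).  The uniqueness of
    the minimizer is the uniqueness of this limit.

    The hypotheses are symmetric under exchanging the roles of (F, x_n, y_n)
    and (G, y_n, x_(n+1)); the statements about y_n are obtained in this way. *)

(** * Distances and geodesics *)

Section metric.
Context {R : realType} {X : metricType R}.
Implicit Types x y z : X.

Lemma mdist_lipschitz x y z : `|mdist x y - mdist x z| <= mdist y z.
Proof.
have := metric_triangle x y z; have := metric_triangle x z y.
by rewrite (metric_sym z y) ler_norml => A B; apply/andP; split; lra.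
Qed.

Lemma cvg_mdist T (F : set_system T) {FF : Filter F} (u : T -> X) x z :
  u @ F --> z -> (fun t => mdist x (u t)) @ F --> mdist x z.
Proof.
move=> /cvgrPdist_lt uz.
apply/(@pseudometric_normed_Zmodule.cvgrPdist_lt) => e e0.
apply: filterS (uz e e0) => t /=; apply: le_lt_trans.
exact: mdist_lipschitz.
Qed.

Lemma cvg_mdist0 T (F : set_system T) {FF : Filter F} (u : T -> X) z :
  (fun t => mdist z (u t)) @ F --> (0 : R) -> u @ F --> z.
Proof.
move=> /(@pseudometric_normed_Zmodule.cvgrPdist_lt) u0.
apply/cvgrPdist_lt => e e0.
by apply: filterS (u0 e e0) => t; rewrite sub0r normrN ger0_norm// mdist_ge0.
Qed.

End metric.

Section geometry.
Context {R : realType} {X : hadamardType R}.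
Implicit Types (x y z p q : X) (l : R).

(** The Cauchy-Schwarz inequality of Hadamard spaces: in a Hilbert space the
    difference of the sums of squares is twice the scalar product of x - y and
    p - q.  It follows by estimating the distance from y to p through a single
    point of the geodesic from x to q. *)
Lemma quadrilateral x y p q :
  mdist x q ^+ 2 + mdist y p ^+ 2 <=
  mdist x p ^+ 2 + mdist y q ^+ 2 + 2 * mdist x y * mdist p q.
Proof.
have [->|xy] := eqVneq x y; first by rewrite mdistxx; lra.
have [->|pq] := eqVneq p q; first by rewrite mdistxx; lra.
rewrite -!mdist_gt0 in xy pq.
(* This parameter makes the weights (1 - l) d(x, y)^2 / l and
   l d(p, q)^2 / (1 - l) both equal to d(x, y) d(p, q). *)
pose l := mdist x y / (mdist x y + mdist p q).
have s0 : 0 < mdist x y + mdist p q by rewrite addr_gt0.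
have l0 : 0 < l by rewrite divr_gt0.
have l1 : 0 < 1 - l by rewrite subr_gt0 ltr_pdivrMr//; lra.
have lE : (1 - l) * mdist x y = l * mdist p q.
  have : l * (mdist x y + mdist p q) = mdist x y by rewrite divfK ?gt_eqF.
  by lra.
have hl : 0 <= l <= 1 by apply/andP; split; lra.
have := geodesicP x q hl; set m := geodesic x q l => hm.
have := metric_triangle y m p; have := hm y; have := hm p.
rewrite (metric_sym m p) (metric_sym y x) (metric_sym p x).
have := mdist_ge0 y m; have := mdist_ge0 p m; have := mdist_ge0 y p.
move: (mdist y m) (mdist p m) (mdist y p) (mdist x y) (mdist p q) lE
  (mdist x q) (mdist x p) (mdist y q) => u v w a b lE D e f w0 v0 u0 hv hu T.
have k0 : 0 < l * (1 - l) by rewrite mulr_gt0.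
rewrite -(ler_pM2l k0).
have H1 : l * (1 - l) * w ^+ 2 <= l * (1 - l) * (u + v) ^+ 2.
  by rewrite ler_pM2l// ler_sqr ?nnegrE ?addr_ge0.
(* Convexity of the square: u + v = l (u / l) + (1 - l) (v / (1 - l)). *)
have H2 : l * (1 - l) * (u + v) ^+ 2 <= (1 - l) * u ^+ 2 + l * v ^+ 2.
  by have := sqr_ge0 ((1 - l) * u - l * v); nra.
have H3 := ler_wpM2l (ltW l1) hu; have H4 := ler_wpM2l (ltW l0) hv.
have H5 : ((1 - l) * a) ^+ 2 + (l * b) ^+ 2 = 2 * (l * (1 - l)) * (a * b).
  have -> : 2 * (l * (1 - l)) * (a * b) = 2 * (((1 - l) * a) * (l * b)) by ring.
  by rewrite lE; ring.
by nra.
Qed.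

Lemma quadrilateral_weak x y p q :
  mdist x q ^+ 2 + mdist y p ^+ 2 <=
  mdist x p ^+ 2 + mdist y q ^+ 2 + mdist x y ^+ 2 + mdist p q ^+ 2.
Proof.
have := quadrilateral x y p q; have := sqr_ge0 (mdist x y - mdist p q).
by nra.
Qed.

Lemma half01 : 0 <= (2^-1 : R) <= 1. Proof. by apply/andP; split; lra. Qed.

Lemma midpointP x y z : mdist z (geodesic x y 2^-1) ^+ 2 <=
  2^-1 * mdist z x ^+ 2 + 2^-1 * mdist z y ^+ 2 - 4^-1 * mdist x y ^+ 2.
Proof. by have := geodesicP x y half01 z; lra. Qed.

(** Joint convexity of the squared distance at midpoints, which makes the
    coupling term of the objective convex. *)
Lemma sqr_mdist_midpoint_convex x x' y y' :
  mdist (geodesic x x' 2^-1) (geodesic y y' 2^-1) ^+ 2 <=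
  2^-1 * mdist x y ^+ 2 + 2^-1 * mdist x' y' ^+ 2.
Proof.
set m := geodesic x x' 2^-1.
have := midpointP y y' m; have := midpointP x x' y; have := midpointP x x' y'.
have := quadrilateral_weak x y x' y'; rewrite -/m.
rewrite (metric_sym m y) (metric_sym m y').
by rewrite (metric_sym y x) (metric_sym y' x) (metric_sym y' x'); lra.
Qed.

Lemma mdist_geodesicl x y l : 0 <= l <= 1 ->
  mdist x (geodesic x y l) = l * mdist x y.
Proof.
move=> l01; have /andP[l0 l1] := l01.
have Px := geodesicP x y l01 x; have Py := geodesicP x y l01 y.
have T := metric_triangle x (geodesic x y l) y.
rewrite mdistxx in Px; rewrite mdistxx (metric_sym y x) in Py.
rewrite (metric_sym (geodesic x y l) y) in T.
have Hx : mdist x (geodesic x y l) <= l * mdist x y.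
  rewrite -ler_sqr ?nnegrE ?mulr_ge0 ?mdist_ge0//; nra.
have Hy : mdist y (geodesic x y l) <= (1 - l) * mdist x y.
  rewrite -ler_sqr ?nnegrE ?mulr_ge0 ?mdist_ge0 ?subr_ge0//; nra.
by apply/eqP; rewrite eq_le Hx /=; lra.
Qed.

Lemma mdist_geodesicr x y l : 0 <= l <= 1 ->
  mdist (geodesic x y l) y = (1 - l) * mdist x y.
Proof.
move=> l01; have /andP[l0 l1] := l01.
have Py := geodesicP x y l01 y.
have T := metric_triangle x (geodesic x y l) y.
rewrite mdistxx (metric_sym y x) in Py.
rewrite mdist_geodesicl// in T.
have Hy : mdist (geodesic x y l) y <= (1 - l) * mdist x y.
  rewrite -ler_sqr ?nnegrE ?mulr_ge0 ?mdist_ge0 ?subr_ge0// metric_sym; nra.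
by apply/eqP; rewrite eq_le Hy /=; lra.
Qed.

Lemma geodesic_geodesic x y l m : 0 <= l <= 1 -> 0 <= m <= 1 ->
  geodesic x (geodesic x y l) m = geodesic x y (m * l).
Proof.
move=> l01 m01; have /andP[l0 l1] := l01; have /andP[m0 m1] := m01.
have ml01 : 0 <= m * l <= 1 by rewrite mulr_ge0//= mulr_ile1.
apply: (geodesic_point_unique ml01); last exact: geodesicP.
move=> z; have := geodesicP x (geodesic x y l) m01 z.
have := ler_wpM2l m0 (geodesicP x y l01 z).
by rewrite mdist_geodesicl//; nra.
Qed.

Lemma mdist_geodesic x y l m : 0 <= l <= 1 -> 0 <= m <= 1 ->
  mdist (geodesic x y l) (geodesic x y m) <= `|l - m| * mdist x y.
Proof.
move=> l01 m01.
rewrite -ler_sqr ?nnegrE ?mulr_ge0 ?mdist_ge0//.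
have := geodesicP x y m01 (geodesic x y l).
rewrite (metric_sym _ x) mdist_geodesicl// mdist_geodesicr// !exprMn.
by rewrite -normrX ger0_norm ?sqr_ge0//; nra.
Qed.

End geometry.

(** * Minimizers of strongly convex functions *)

Lemma lte_between (R : realType) (a : R) (v : \bar R) : (a%:E < v)%E ->
  exists2 b, a < b & (b%:E < v)%E.
Proof.
case: v => [r|_|//]; last by exists (a + 1); [lra|exact: ltry].
by rewrite lte_fin => ar; exists ((a + r) / 2); rewrite ?lte_fin; lra.
Qed.

Section strongly_convex.
Context {R : realType} {X : hadamardType R}.
Implicit Types (x y z p q : X) (F : X -> \bar R) (k : R).

(** The bounds a and b are real, so that points where F is infinite impose
    nothing and no arithmetic on infinite values occurs. *)
Definition strongly_midconvex k F := forall p q (a b : R),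
  (F p <= a%:E)%E -> (F q <= b%:E)%E ->
  exists m, (F m <= (2^-1 * a + 2^-1 * b - k * mdist p q ^+ 2)%:E)%E.

(** Near-minimal points are close to each other, so the sublevel sets just above
    the infimum generate a Cauchy filter; lower semicontinuity says that its
    limit is a minimizer. *)
Lemma strongly_midconvex_minimizer k F : 0 < k -> strongly_midconvex k F ->
  lower_semicontinuous F -> (exists p, (F p < +oo)%E) ->
  (exists M : R, forall p, (M%:E <= F p)%E) -> exists p, minimizers F p.
Proof.
move=> k0 Fk Fl [p0 Fp0] [M FM].
pose V := [set a : R | exists p, (F p <= a%:E)%E].
have fin p : (F p < +oo)%E -> F p = (fine (F p))%:E.
  by move=> ?; rewrite fineK// fin_real// (lt_le_trans _ (FM p)) ?ltNyr.
have hI : has_inf V.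
  split; first by exists (fine (F p0)), p0; rewrite -fin.
  by exists M => a [p Fpa]; rewrite -lee_fin (le_trans (FM p)).
pose I := inf V.
have IF p (a : R) : (F p <= a%:E)%E -> I <= a.
  by move=> Fpa; apply: ge_inf; [exact: hI.2|exists p].
pose S e := [set z | (F z <= (I + e)%:E)%E].
pose G := filter_from [set e : R | 0 < e] S.
have SG : ProperFilter G.
  apply: filter_from_proper; last first.
    move=> e /= e0; have [a [z Fz] ze] := inf_adherent e0 hI.
    by exists z; rewrite /S /= (le_trans Fz)// lee_fin ltW.
  apply: filter_from_filter; first by exists 1 => /=.
  move=> e1 e2 /= e10 e20; exists (Num.min e1 e2); first by rewrite lt_min e10.
  by move=> z; rewrite /S /= => h; split; apply: (le_trans h);
    rewrite lee_fin lerD2l ge_min lexx ?orbT.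
have cG : cauchy G.
  apply/cauchy_ballP => e e0.
  have d0 : 0 < k * e ^+ 2 / 2 by rewrite divr_gt0// mulr_gt0// exprn_gt0.
  exists (S (k * e ^+ 2 / 2), S (k * e ^+ 2 / 2)).
    by split; exists (k * e ^+ 2 / 2).
  move=> [p q] [/= hp hq]; rewrite ballEmdist /=.
  have [m /IF hm] := Fk _ _ _ _ hp hq.
  rewrite -ltr_sqr ?nnegrE ?mdist_ge0 ?(ltW e0)// -(ltr_pM2l k0).
  by move: d0 hm; lra.
have /cvg_ex [p Gp] : cvg G by exact: cauchy_cvg.
exists p => q; rewrite leNgt; apply/negP => Fqp.
have Fq : (F q < +oo)%E by rewrite (lt_le_trans Fqp) ?leey.
have [r qr rp] : exists2 r, I < r & (r%:E < F p)%E.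
  apply: lte_between; apply: le_lt_trans Fqp.
  by rewrite fin// lee_fin; apply: (IF q); rewrite -fin.
have [W Wp WF] := Fl p r rp.
have GS : G (S (r - I)) by exists (r - I) => //=; rewrite subr_gt0.
have [z [/WF Wz]] := filter_ex (filterI (Gp _ Wp) GS).
by rewrite /S /= addrC subrK leNgt Wz.
Qed.

Lemma strongly_midconvex_unique k F p q (a : R) :
  0 < k -> strongly_midconvex k F ->
  minimizers F p -> F p = a%:E -> (F q <= a%:E)%E -> q = p.
Proof.
move=> k0 Fk pmin Fp Fq; apply: mdist_positivity.
have [m Fm] := Fk _ _ _ _ Fq (eq_ind_r (fun t => t <= a%:E)%E (lexx _) Fp).
have := le_trans (pmin m) Fm; rewrite Fp lee_fin => h.
have : k * mdist q p ^+ 2 <= 0 by lra.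
rewrite pmulr_rle0// => h'; apply/eqP.
by rewrite -sqrf_eq0 eq_le h' sqr_ge0.
Qed.

End strongly_convex.

(** * Proximal operators *)

Section convex_functions.
Context {R : realType} {X : hadamardType R}.
Implicit Types (x y z p q : X) (F : X -> \bar R).

Lemma proper_fin_num F x : proper_fun F -> (F x < +oo)%E -> F x \is a fin_num.
Proof. by move=> [_ Fp] Fx; rewrite fin_numE Fp lt_eqF. Qed.

Lemma econvex_fine F x y (l : R) : proper_fun F -> econvex F -> 0 <= l <= 1 ->
  F x \is a fin_num -> F y \is a fin_num ->
  F (geodesic x y l) \is a fin_num /\
  fine (F (geodesic x y l)) <= (1 - l) * fine (F x) + l * fine (F y).
Proof.
move=> Fp Fc l01 Fx Fy; have := Fc x y l l01.
rewrite -(fineK Fx) -(fineK Fy) -!EFinM -EFinD /= => H.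
have Fg : F (geodesic x y l) \is a fin_num.
  by apply: proper_fin_num => //; rewrite (le_lt_trans H) ?ltry.
by split=> //; rewrite -lee_fin (fineK Fg).
Qed.

End convex_functions.

Section prox_operator.
Context {R : realType} {X : hadamardType R}.
Implicit Types (x y z p q : X) (F : X -> \bar R) (P : X -> X).

(** P is characterized by the proximal inequality with its quadratic gain,
    in real terms on the domain of F.  Later arguments use only this. *)
Definition prox_operator F P := forall x, F (P x) \is a fin_num /\
  forall z, F z \is a fin_num ->
    fine (F (P x)) + 2^-1 * mdist x (P x) ^+ 2 + 2^-1 * mdist (P x) z ^+ 2
    <= fine (F z) + 2^-1 * mdist x z ^+ 2.

(** Adding the proximal inequalities at x and at y and bounding the cross terms
    by [quadrilateral] leaves d(Px, Py)^2 <= d(x, y) d(Px, Py). *)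
Lemma prox_operator_nonexpansive F P x y : prox_operator F P ->
  mdist (P x) (P y) <= mdist x y.
Proof.
move=> PF; have [Fx Hx] := PF x; have [Fy Hy] := PF y.
have := Hx _ Fy; have := Hy _ Fx; have := quadrilateral x y (P x) (P y).
rewrite (metric_sym (P y) (P x)) => q hy hx.
have h : mdist (P x) (P y) ^+ 2 <= mdist x y * mdist (P x) (P y) by lra.
have [e|e] := eqVneq (P x) (P y); first by rewrite e mdistxx mdist_ge0.
by rewrite -(@ler_pM2r _ (mdist (P x) (P y))) ?mdist_gt0// -expr2.
Qed.

(** The quadratic minorant of F assumed here is what a lower bound of the joint
    energy gives when its second argument is a fixed point x0. *)
Section existence.
Variable F : X -> \bar R.
Hypotheses (Fp : proper_fun F) (Fc : econvex F) (Fl : lower_semicontinuous F).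
Variables (x0 : X) (M : R).
Hypothesis FM : forall z, F z \is a fin_num ->
  M <= fine (F z) + 2^-1 * mdist x0 z ^+ 2.

Let V x y := (F y + (2^-1 * mdist x y ^+ 2)%:E)%E.

Let V_fin x y (a : R) : (V x y <= a%:E)%E ->
  F y \is a fin_num /\ fine (F y) + 2^-1 * mdist x y ^+ 2 <= a.
Proof.
rewrite /V => h.
have Fy : F y \is a fin_num.
  apply: proper_fin_num => //; rewrite ltNge; apply/negP; rewrite leye_eq.
  by move=> /eqP Fy; move: h; rewrite Fy addye.
by split=> //; rewrite -lee_fin EFinD fineK.
Qed.

Let V_lsc x : lower_semicontinuous (V x).
Proof.
move=> z a; rewrite /V -lteBlDr// => /lte_between[b ab bz].
have [W Wz WF] := Fl bz.
have dz : (fun y => 2^-1 * (mdist x y * mdist x y)) @ z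
    --> 2^-1 * (mdist x z * mdist x z).
  by apply: cvgMr; apply: cvgM; apply: cvg_mdist; exact: cvg_id.
have /(cvgr_gt _ dz) H : a - b < 2^-1 * (mdist x z * mdist x z).
  by rewrite -expr2; lra.
exists (W `&` [set y | a - b < 2^-1 * (mdist x y * mdist x y)]).
  exact: filterI.
move=> y [/WF Wy /= Hy]; have {1}-> : a = b + (a - b) by lra.
by rewrite EFinD lteD// lte_fin expr2.
Qed.

Let V_midconvex x : strongly_midconvex 8^-1 (V x).
Proof.
move=> p q a b /V_fin [Fpf ha] /V_fin [Fqf hb].
exists (geodesic p q 2^-1).
have [Fm hm] := econvex_fine Fp Fc (@half01 R) Fpf Fqf.
rewrite /V -(fineK Fm) -EFinD lee_fin.
by have := midpointP p q x; lra.
Qed.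

(** The minorant around x0 does not directly bound the energy around another x:
    the two squared distances differ by an unbounded linear term.  Applying the
    minorant at the midpoint between y and a point a of the domain uses the
    convexity of F to gain a quarter of d(a, y)^2, which absorbs that term. *)
Let V_bounded x : exists m : R, forall y, (m%:E <= V x y)%E.
Proof.
have [[a Fa] _] := Fp.
have {}Fa : F a \is a fin_num by apply: proper_fin_num; rewrite ?ltey.
pose D := mdist x0 a; pose E := mdist x a.
exists (2 * M - fine (F a) - D ^+ 2 - (2^-1 * E + D) ^+ 2 - D * E - E ^+ 2 - 1).
move=> y.
rewrite leNgt; apply/negP => /ltW /V_fin [Fy].
have [Fm hm] := econvex_fine Fp Fc (@half01 R) Fa Fy.
have := midpointP a y x0; have := FM Fm; have := metric_triangle x0 a y.
have := metric_triangle a x y; rewrite -/D (metric_sym a x) -/E.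
have : 0 <= D := mdist_ge0 _ _; have : 0 <= E := mdist_ge0 _ _.
have := mdist_ge0 x0 y; have := mdist_ge0 a y; have := mdist_ge0 x y.
move: (mdist x y) (mdist a y) (mdist x0 y) => r t s.
move=> r0 t0 s0 E0 D0 ht hs h1 h2 h3.
have : s ^+ 2 <= (D + t) ^+ 2 by rewrite ler_sqr ?nnegrE ?addr_ge0.
have : t ^+ 2 <= (E + r) ^+ 2 by rewrite ler_sqr ?nnegrE ?addr_ge0.
have : D * t <= D * (E + r) by rewrite ler_wpM2l.
have := sqr_ge0 (2^-1 * r - (2^-1 * E + D)); have := sqr_ge0 E.
by lra.
Qed.

Lemma Prox_minimizer x : minimizers (V x) (Prox F x).
Proof.
have dom : exists a, (V x a < +oo)%E.
  by have [[a Fa] _] := Fp; exists a; rewrite lte_add_pinfty ?ltry// ltey.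
have k0 : (0 : R) < 8^-1 by [].
apply: xgetPex.
exact: strongly_midconvex_minimizer k0 (@V_midconvex x) (@V_lsc x) dom
  (V_bounded x).
Qed.

(** Minimality of p against the point of parameter l on the geodesic from p to
    z gives the proximal inequality with gain (1 - l) d(p, z)^2 / 2; then l is
    taken close to 0. *)
Lemma Prox_operator : prox_operator F (Prox F).
Proof.
move=> x; have pmin := @Prox_minimizer x; set p := Prox F x in pmin *.
have Fpf : F p \is a fin_num.
  have [[a Fa] _] := Fp; have Faf : F a \is a fin_num.
    by apply: proper_fin_num; rewrite ?ltey.
  by have := pmin a; rewrite {2}/V -(fineK Faf) -EFinD => /V_fin[].
split=> // z Fz.
set A := (_ + _ + _); set B := (_ + _); apply/ler_addgt0Pr => e e0.
pose D := mdist p z ^+ 2.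
have D0 : 0 <= D by exact: sqr_ge0.
(* With this parameter the loss l D in the gain is at most e. *)
pose l := e / (D + e).
have De : 0 < D + e by rewrite ltr_wpDl.
have l0 : 0 < l by rewrite divr_gt0.
have l1 : l <= 1 by rewrite ler_pdivrMr// mul1r lerDr.
have lD : l * D <= e.
  by rewrite /l mulrAC ler_pdivrMr// ler_pM2l// lerDl ltW.
have l01 : 0 <= l <= 1 by rewrite (ltW l0).
have [Fg hg] := econvex_fine Fp Fc l01 Fpf Fz.
have := pmin (geodesic p z l); rewrite /V -(fineK Fg) -(fineK Fpf) -!EFinD.
rewrite lee_fin => h; have := geodesicP p z l01 x; rewrite -/D => g.
rewrite -(ler_pM2l l0) /A /B -/D.
have : l * (l * D) <= l * e by rewrite ler_pM2l.
have : 0 < l * e by rewrite mulr_gt0.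
by lra.
Qed.

End existence.
End prox_operator.

(** * Series with bounded partial sums *)

Section bounded_sums.
Context {R : realType}.
Implicit Types (u v a : R^nat).

Definition bounded_sums u := exists B : R, forall n, \sum_(0 <= k < n) u k <= B.

Lemma nneseries_lty_bounded_sums u : (forall n, 0 <= u n) ->
  (\sum_(0 <= n <oo) (u n)%:E < +oo)%E <-> bounded_sums u.
Proof.
move=> u0; split=> [uoo|[B uB]].
  exists (fine (\sum_(0 <= n <oo) (u n)%:E)) => n.
  rewrite -lee_fin fineK; last first.
    by rewrite ge0_fin_numE// nneseries_ge0// => k _ _; rewrite lee_fin.
  by rewrite -sumEFin; apply: nneseries_lim_ge => k _ _; rewrite lee_fin.
rewrite (@le_lt_trans _ _ B%:E) ?ltry//; apply: lime_le.
  by apply: is_cvg_nneseries => n _ _; rewrite lee_fin.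
by apply: nearW => n; rewrite sumEFin lee_fin.
Qed.

Lemma bounded_sums_le u v : (forall n, u n <= v n) ->
  bounded_sums v -> bounded_sums u.
Proof.
by move=> uv [B vB]; exists B => n; apply: le_trans (vB n); apply: ler_sum.
Qed.

Lemma bounded_sumsD u v : bounded_sums u -> bounded_sums v ->
  bounded_sums (fun n => u n + v n).
Proof.
by move=> [A uA] [B vB]; exists (A + B) => n; rewrite big_split lerD.
Qed.

Lemma bounded_sumsM (c : R) u : 0 <= c -> bounded_sums u ->
  bounded_sums (fun n => c * u n).
Proof.
move=> c0 [A uA]; exists (c * A) => n.
by rewrite -mulr_sumr ler_wpM2l.
Qed.

Lemma bounded_sums_shift u : (forall n, 0 <= u n) ->
  bounded_sums u -> bounded_sums (fun n => u n.+1).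
Proof.
move=> u0 [A uA]; exists A => n; apply: le_trans (uA n.+1).
by rewrite big_nat_recl//= lerDr.
Qed.

Lemma bounded_sums_unshift u : bounded_sums (fun n => u n.+1) -> bounded_sums u.
Proof.
move=> [A uA]; exists (Num.max 0 (u 0%N + A)) => -[|n].
  by rewrite big_geq// le_max lexx.
by rewrite big_nat_recl//= le_max lerD2l uA orbT.
Qed.

Lemma bounded_sums_bounded u : (forall n, 0 <= u n) ->
  bounded_sums u -> exists2 B, 0 <= B & forall n, u n <= B.
Proof.
move=> u0 [A uA]; exists A; first by have := uA 0%N; rewrite big_geq.
move=> n; apply: le_trans (uA n.+1); rewrite big_nat_recr//= lerDr.
exact: sumr_ge0.
Qed.

Lemma bounded_sums_sqr u : (forall n, 0 <= u n) ->
  bounded_sums u -> bounded_sums (fun n => u n ^+ 2).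
Proof.
move=> u0 su; have [B B0 uB] := bounded_sums_bounded u0 su.
apply: bounded_sums_le (bounded_sumsM B0 su) => n.
by rewrite expr2 ler_wpM2r.
Qed.

Lemma bounded_sums_cvg u : (forall n, 0 <= u n) -> bounded_sums u ->
  cvgn (series u).
Proof.
move=> u0 [B uB]; apply: nondecreasing_is_cvgn.
  exact: nondecreasing_series.
by exists B => _ [n _ <-]; exact: uB.
Qed.

Lemma bounded_sums_cvg0 u : (forall n, 0 <= u n) -> bounded_sums u ->
  u @ \oo --> (0 : R).
Proof. by move=> u0 su; apply: cvg_series_cvg_0; exact: bounded_sums_cvg. Qed.

Lemma telescope_bounded_sums (e b h : R^nat) (M : R) :
  (forall n, M <= e n) -> bounded_sums h ->
  (forall n, e n.+1 + b n <= e n + h n) -> bounded_sums b.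
Proof.
move=> eM [B hB] st; exists (e 0%N + B - M) => n.
suff H : e n + \sum_(0 <= k < n) b k <= e 0%N + \sum_(0 <= k < n) h k.
  by have := hB n; have := eM n; lra.
elim: n => [|n IH]; first by rewrite !big_geq.
by rewrite !big_nat_recr//=; have := st n; lra.
Qed.

Lemma almost_nonincreasing_bounded a (h : R^nat) : bounded_sums h ->
  (forall n, a n.+1 <= a n + h n) -> exists A, forall n, a n <= A.
Proof.
move=> [B hB] st; exists (a 0%N + B) => n; have := hB n.
suff : a n <= a 0%N + \sum_(0 <= k < n) h k by lra.
elim: n => [|n IH]; first by rewrite big_geq// addr0.
by rewrite big_nat_recr//=; have := st n; lra.
Qed.

(** Subtracting the partial sums of the errors turns a into a nonincreasing
    sequence bounded below. *)
Lemma almost_nonincreasing_cvg a (h : R^nat) :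
  (forall n, 0 <= a n) -> (forall n, 0 <= h n) -> bounded_sums h ->
  (forall n, a n.+1 <= a n + h n) -> cvgn a.
Proof.
move=> a0 h0 sh st; have ch := bounded_sums_cvg h0 sh.
have -> : a = (a - series h) + series h by apply/funext => n /=; rewrite subrK.
apply: is_cvgD => //; apply: nonincreasing_is_cvgn.
  apply/nonincreasing_seqP => n; rewrite !fctE /series /= big_nat_recr//=.
  by have := st n; lra.
have [B hB] := sh; exists (- B) => _ [n _ <-]; rewrite !fctE /series /=.
by have := a0 n; have := hB n; lra.
Qed.

End bounded_sums.

(** * Inexact alternating proximal steps *)

Section alternation.
Context {R : realType} {X : hadamardType R}.
Implicit Types (F G : X -> \bar R) (P Q : X -> X).
Implicit Types (x y : nat -> X) (a b c d : X).

Definition joint_energy F G a b : R :=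
  fine (F a) + fine (G b) + 2^-1 * mdist a b ^+ 2.

Definition inexact_alternation P Q x y :=
  bounded_sums (fun n => mdist (y n) (Q (x n))) /\
  bounded_sums (fun n => mdist (x n.+1) (P (y n))).

Lemma joint_energyC F G a b : joint_energy G F b a = joint_energy F G a b.
Proof. by rewrite /joint_energy metric_sym [fine (G b) + _]addrC. Qed.

(** Shifting x by one step exchanges the roles of the two maps, so that each
    result on x gives one on y. *)
Lemma inexact_alternationC P Q x y :
  inexact_alternation P Q x y -> inexact_alternation Q P y (fun n => x n.+1).
Proof.
move=> [hy hx]; split=> //.
by apply: bounded_sums_shift hy => n; exact: mdist_ge0.
Qed.

Section two_proxes.
Variables (F G : X -> \bar R) (P Q : X -> X).
Hypotheses (PF : prox_operator F P) (QG : prox_operator G Q).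

Let psi := joint_energy F G.

(** One exact round of the alternation compared with an arbitrary pair: the sum
    of the two proximal inequalities, whose cross terms are those of the
    quadrilateral a, c, d, Q a. *)
Lemma alternation_decrease a c d :
  F c \is a fin_num -> G d \is a fin_num ->
  psi (P (Q a)) (Q a) + 2^-1 * mdist (P (Q a)) c ^+ 2 <=
  psi c d + 2^-1 * mdist a c ^+ 2.
Proof.
move=> Fc Gd; have [_ /(_ _ Fc) hF] := PF (Q a); have [_ /(_ _ Gd) hG] := QG a.
have := quadrilateral_weak a c (Q a) d.
rewrite (metric_sym c (Q a)) /psi /joint_energy (metric_sym (P (Q a)) (Q a)).
by lra.
Qed.

(** At a fixed pair the squared distances of [alternation_decrease] cancel. *)
Lemma fixed_pair_minimizes a b c d : a = P b -> b = Q a ->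
  F c \is a fin_num -> G d \is a fin_num -> psi a b <= psi c d.
Proof.
by move=> aP bQ Fc Gd; have := alternation_decrease a Fc Gd;
  rewrite -bQ -aP lerD2r.
Qed.

(** Minimality in the first variable alone already forces a = P b; the other
    equation follows by exchanging F and G. *)
Lemma minimizer_eq_prox a b : F a \is a fin_num -> G b \is a fin_num ->
  (forall c, F c \is a fin_num -> psi a b <= psi c b) -> a = P b.
Proof.
move=> Fa Gb ab; have [FP /(_ _ Fa) h] := PF b; have := ab _ FP.
rewrite /psi /joint_energy (metric_sym a b) (metric_sym (P b) b) => k.
apply/esym/mdist_positivity/eqP; rewrite -sqrf_eq0 eq_le sqr_ge0 andbT.
by lra.
Qed.

Variables (x y : nat -> X).
Hypothesis xy : inexact_alternation P Q x y.

Let eta n := mdist (y n) (Q (x n)) + mdist (x n.+1) (P (y n)).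

Let eta_ge0 n : 0 <= eta n. Proof. by rewrite addr_ge0// mdist_ge0. Qed.

Let eta_sums : bounded_sums eta.
Proof. by have [h1 h2] := xy; exact: bounded_sumsD. Qed.

Let x_exact n : mdist (x n.+1) (P (Q (x n))) <= eta n.
Proof.
have := metric_triangle (x n.+1) (P (y n)) (P (Q (x n))).
have := prox_operator_nonexpansive (y n) (Q (x n)) PF.
by rewrite /eta; lra.
Qed.

Let PQ_nonexpansive a b : mdist (P (Q a)) (P (Q b)) <= mdist a b.
Proof.
apply: le_trans (prox_operator_nonexpansive _ _ PF) _.
exact: prox_operator_nonexpansive QG.
Qed.

(** By nonexpansiveness consecutive steps grow only by the summable errors. *)
Lemma alternation_steps_bounded : exists B, forall n, mdist (x n.+1) (x n) <= B.
Proof.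
apply: (@almost_nonincreasing_bounded _ _ (fun n => eta n.+1 + eta n)).
  by apply: bounded_sumsD => //; exact: bounded_sums_shift.
move=> n; have := PQ_nonexpansive (x n.+1) (x n).
have := x_exact n.+1; have := x_exact n.
have := metric_triangle (x n.+2) (P (Q (x n.+1))) (x n.+1).
have := metric_triangle (P (Q (x n.+1))) (P (Q (x n))) (x n.+1).
by rewrite (metric_sym (P (Q (x n))) (x n.+1)); lra.
Qed.

(** The energy of the exact rounds (u n, v n) started at the actual iterates
    decreases by half the squared step, up to the error made at each iteration
    times the length of a step. *)
Lemma alternation_sqr_steps (M : R) :
  (forall a b, F a \is a fin_num -> G b \is a fin_num -> M <= psi a b) ->
  bounded_sums (fun n => mdist (x n.+1) (x n) ^+ 2).
Proof.
move=> psiM; pose u n := P (Q (x n)); pose v n := Q (x n).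
have uv_sums : bounded_sums (fun n => 2^-1 * mdist (u n) (u n.+1) ^+ 2).
  have [B xB] := alternation_steps_bounded.
  have B0 : 0 <= B by apply: le_trans (xB 0%N); exact: mdist_ge0.
  apply: (telescope_bounded_sums (e := fun n => psi (u n) (v n)) (M := M)
      (h := fun n => B * eta n)).
  - by move=> n; apply: psiM; [exact: (PF _).1|exact: (QG _).1].
  - exact: bounded_sumsM.
  move=> n; have [_ hF] := PF (v n.+1); have [_ hG] := QG (x n.+1).
  have := hF (u n) (PF _).1; have := hG (v n) (QG _).1.
  (* The four distances left over compare u n with x n.+1 on one side and v n
     with v n.+1 on the other: this is where the error is multiplied by the
     length of a step, rather than by distances between u and v. *)
  have := quadrilateral (u n) (x n.+1) (v n) (v n.+1).
  have := sqr_ge0 (mdist (v n.+1) (v n)).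
  have : mdist (u n) (x n.+1) * mdist (v n) (v n.+1) <= B * eta n.
    rewrite mulrC ler_pM ?mdist_ge0//; last by rewrite metric_sym x_exact.
    apply: le_trans (xB n); rewrite (metric_sym (x n.+1)).
    exact: prox_operator_nonexpansive QG.
  rewrite /psi /joint_energy -/(u n.+1) -/(v n.+1).
  rewrite (metric_sym (v n.+1) (u n.+1)) (metric_sym (v n.+1) (u n)).
  rewrite (metric_sym (u n.+1) (u n)).
  by lra.
have eta2_sums : bounded_sums (fun n => (eta n.+1 + eta n) ^+ 2).
  apply: bounded_sums_sqr => [n|]; first exact: addr_ge0.
  by apply: bounded_sumsD => //; exact: bounded_sums_shift.
(* The step from x n.+1 to x n.+2 is compared with the step from u n to u n.+1,
   so the first step has to be left out. *)
apply: bounded_sums_unshift.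
apply: bounded_sums_le (bounded_sumsD (bounded_sumsM (ler0n R 2) eta2_sums)
  (bounded_sumsM (ler0n R 4) uv_sums)) => n.
have := x_exact n.+1; have := x_exact n; rewrite -/(u n) -/(u n.+1).
have := metric_triangle (x n.+2) (u n.+1) (x n.+1).
have := metric_triangle (u n.+1) (u n) (x n.+1).
rewrite (metric_sym (u n) (x n.+1)) (metric_sym (u n.+1) (u n)).
have := mdist_ge0 (u n) (u n.+1); have := mdist_ge0 (x n.+2) (x n.+1).
have := eta_ge0 n; have := eta_ge0 n.+1.
move: (mdist (x n.+2) (x n.+1)) (mdist (u n) (u n.+1)) => s t e1 e0 s0 t0.
move=> h1 h2 h3 h4.
have : s ^+ 2 <= (eta n.+1 + eta n + t) ^+ 2.
  by rewrite ler_sqr ?nnegrE//; lra.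
by have := sqr_ge0 (eta n.+1 + eta n - t); nra.
Qed.

Section minimizer.
Variables (a b : X).
Hypotheses (aP : a = P b) (bQ : b = Q a).

(** Since a is a fixed point of the nonexpansive map P Q, the distance of the
    iterates to it increases only through the errors. *)
Lemma alternation_cvg_dist : cvgn (fun n => mdist (x n) a).
Proof.
apply: (almost_nonincreasing_cvg _ eta_ge0 eta_sums) => n.
  exact: mdist_ge0.
have := PQ_nonexpansive (x n) a; rewrite -bQ -aP.
have := metric_triangle (x n.+1) (P (Q (x n))) a; have := x_exact n.
by lra.
Qed.

(** The energy gap is nonnegative and bounded by the difference of two squared
    distances to a that have the same limit. *)
Lemma alternation_energy_cvg :
  (fun n => psi (P (Q (x n))) (Q (x n))) @ \oo --> psi a b.
Proof.
have Fa : F a \is a fin_num by rewrite aP; exact: (PF _).1.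
have Gb : G b \is a fin_num by rewrite bQ; exact: (QG _).1.
have /cvg_ex [l xl] := alternation_cvg_dist.
have eta0 := bounded_sums_cvg0 eta_ge0 eta_sums.
have xl1 : (fun n => mdist (x n.+1) a) @ \oo --> l.
  by move: xl; rewrite -cvg_shiftS.
have ul : (fun n => mdist (P (Q (x n))) a) @ \oo --> l.
  apply: (@squeeze_cvgr _ _ _ _ (fun n => mdist (x n.+1) a - eta n)
    (fun n => mdist (x n.+1) a + eta n)).
  - apply: nearW => n; have := x_exact n.
    have := metric_triangle (x n.+1) (P (Q (x n))) a.
    have := metric_triangle (P (Q (x n))) (x n.+1) a.
    rewrite (metric_sym (P (Q (x n))) (x n.+1)) => *.
    by apply/andP; split; lra.
  - by rewrite -[X in _ --> X]subr0; exact: cvgB.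
  - by rewrite -[X in _ --> X]addr0; exact: cvgD.
apply: (@squeeze_cvgr _ _ _ _ (fun=> psi a b) (fun n => psi a b +
    2^-1 * (mdist (x n) a * mdist (x n) a -
            mdist (P (Q (x n))) a * mdist (P (Q (x n))) a))).
- apply: nearW => n; apply/andP; split.
    by apply: fixed_pair_minimizes => //; [exact: (PF _).1|exact: (QG _).1].
  by have := alternation_decrease (x n) Fa Gb; rewrite -!expr2; lra.
- exact: cvg_cst.
rewrite -[X in _ --> X]addr0 -[X in _ + X](mulr0 2^-1) -(subrr (l * l)).
apply: cvgD; first exact: cvg_cst.
by apply: cvgMr; exact: (cvgB (cvgM xl xl) (cvgM ul ul)).
Qed.

End minimizer.
End two_proxes.
End alternation.

(** * Asymptotic centers and weak convergence *)

Section asymptotic_radius.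
Context {R : realType} {X : hadamardType R} {T : Type}.
Implicit Types (U : set_system T) (u : T -> X) (p q x z : X).

(** The limit superior along U of the squared distances from z to u, as the
    infimum of their eventual upper bounds.  General filters U stand for
    subsequences. *)
Definition asymptotic_radius U u z : \bar R := ereal_inf
  [set s%:E | s in [set s : R | \forall t \near U, mdist z (u t) ^+ 2 <= s]].

Local Notation rad := asymptotic_radius.

(** Continuity of the square, uniform in the perturbed quantity r. *)
Lemma sqr_perturb (s e : R) : 0 <= s -> 0 < e -> exists2 h, 0 < h &
  forall r t : R, 0 <= r -> 0 <= t -> r ^+ 2 <= s -> t <= r + h ->
    t ^+ 2 <= s + e.
Proof.
move=> s0 e0; have D0 : 0 < 2 * s + 3 by lra.
exists (Num.min 1 (e / (2 * s + 3))); first by rewrite lt_min ltr01 divr_gt0.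
set h := Num.min _ _ => r t r0 t0 rs trh.
have h0 : 0 < h by rewrite lt_min ltr01 divr_gt0.
have h1 : h <= 1 by rewrite ge_min lexx.
have hD : h * (2 * s + 3) <= e by rewrite -ler_pdivlMr// ge_min lexx orbT.
have : t ^+ 2 <= (r + h) ^+ 2 by rewrite ler_sqr ?nnegrE//; lra.
have : h * r <= h * (s + 1).
  by rewrite ler_pM2l//; have := sqr_ge0 (r - 2^-1); nra.
have : h * h <= h * 1 by rewrite ler_pM2l.
by nra.
Qed.

Lemma asymptotic_radius_le U u z (s : R) :
  (\forall t \near U, mdist z (u t) ^+ 2 <= s) -> (rad U u z <= s%:E)%E.
Proof. by move=> h; apply: ereal_inf_lbound; exists s. Qed.

Lemma asymptotic_radius_lt U u z (s : R) : Filter U -> (rad U u z < s%:E)%E ->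
  \forall t \near U, mdist z (u t) ^+ 2 <= s.
Proof.
move=> FU /ereal_inf_lt [_ [r /= h <-]]; rewrite lte_fin => rs.
by apply: filterS h => t /le_trans -> //; exact: ltW.
Qed.

Lemma asymptotic_radius_ge0 U u z : ProperFilter U -> (0 <= rad U u z)%E.
Proof.
move=> FU; apply: le_ereal_inf_tmp => _ [s /= /filter_ex [t ts] <-].
by rewrite lee_fin (le_trans _ ts)// sqr_ge0.
Qed.

Lemma asymptotic_radius_mono U u p q : Filter U ->
  (\forall t \near U, mdist p (u t) <= mdist q (u t)) ->
  (rad U u p <= rad U u q)%E.
Proof.
move=> FU pq; apply: le_ereal_inf_tmp => _ [s /= qs <-].
apply: asymptotic_radius_le; apply: filterS2 pq qs => t pq.
by apply: le_trans; rewrite ler_sqr ?nnegrE ?mdist_ge0.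
Qed.

Lemma asymptotic_radius_midconvex U u : ProperFilter U ->
  strongly_midconvex 4^-1 (rad U u).
Proof.
move=> FU p q a b pa qb; exists (geodesic p q 2^-1).
apply/lee_addgt0Pr => e e0; rewrite -EFinD.
have lt_e v c : (v <= c%:E -> v < (c + e)%:E)%E.
  by move=> /le_lt_trans; apply; rewrite lte_fin ltrDl.
apply: asymptotic_radius_le.
have := asymptotic_radius_lt FU (lt_e _ _ qb).
have := asymptotic_radius_lt FU (lt_e _ _ pa).
apply: filterS2 => t; rewrite !(metric_sym _ (u t)) => hp hq.
by have := midpointP p q (u t); lra.
Qed.

Lemma asymptotic_radius_lsc U u : ProperFilter U ->
  lower_semicontinuous (rad U u).
Proof.
move=> FU x a ax; have [a0|a0] := ltP a 0.
  exists setT; first exact: filterT.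
  move=> z _; apply: lt_le_trans (asymptotic_radius_ge0 _ _ _).
  by rewrite lte_fin.
have [b ab bx] := lte_between ax.
have [||h h0 hP] := @sqr_perturb ((a + b) / 2) ((b - a) / 2); [lra|lra|].
exists (ball x h) => [|y]; first exact: nbhsx_ballx.
rewrite ballEmdist /= => xy; rewrite ltNge; apply/negP => ya.
move: bx; rewrite ltNge => /negP; apply; apply: asymptotic_radius_le.
have : (rad U u y < ((a + b) / 2)%:E)%E.
  by rewrite (le_lt_trans ya)// lte_fin; lra.
move=> /asymptotic_radius_lt; apply: filterS => t yt.
have -> : b = (a + b) / 2 + (b - a) / 2 by lra.
apply: hP yt _; rewrite ?mdist_ge0//.
by have := metric_triangle x y (u t); lra.
Qed.

(** The asymptotic radius is strongly convex, so that it has a minimizer, and no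
    other point has as small a radius. *)
Lemma asymptotic_center U u z (B : R) : ProperFilter U ->
  (\forall t \near U, mdist z (u t) ^+ 2 <= B) ->
  exists c, forall q, (rad U u q <= rad U u c)%E -> q = c.
Proof.
move=> FU zB; have zoo : (rad U u z < +oo)%E.
  by rewrite (le_lt_trans (asymptotic_radius_le zB)) ?ltry.
have k0 : 0 < 4^-1 :> R by [].
have [||c cmin] := strongly_midconvex_minimizer k0
    (@asymptotic_radius_midconvex U u FU) (@asymptotic_radius_lsc U u FU).
- by exists z.
- by exists 0 => p; exact: asymptotic_radius_ge0.
exists c => q; have cfin : rad U u c = (fine (rad U u c))%:E.
  rewrite fineK// ge0_fin_numE ?asymptotic_radius_ge0//.
  exact: le_lt_trans (cmin z) zoo.
rewrite cfin; apply: (strongly_midconvex_unique k0 _ cmin cfin).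
exact: asymptotic_radius_midconvex.
Qed.

Lemma asymptotic_radius_cvg U u z (r : R) : ProperFilter U ->
  (fun t => mdist z (u t) ^+ 2) @ U --> r -> rad U u z = r%:E.
Proof.
move=> FU zr; apply/eqP; rewrite eq_le; apply/andP; split.
  apply/lee_addgt0Pr => e e0; apply: asymptotic_radius_le.
  have re : r < r + e by rewrite ltrDl.
  by apply: filterS (cvgr_lt _ zr _ re) => t /ltW.
apply: le_ereal_inf_tmp => _ [s /= zs <-]; rewrite lee_fin leNgt.
apply/negP => sr.
have [t [h1 h2]] := filter_ex (filterI zs (cvgr_gt _ zr _ sr)).
by move: h2; rewrite /= ltNge h1.
Qed.

End asymptotic_radius.

Section weak_convergence.
Context {R : realType} {X : hadamardType R}.
Implicit Types (u : nat -> X) (x y z c p q : X) (N : X -> X).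

(** c is the asymptotic center of u along every filter finer than that of
    cofinite sets: this is Lim's Delta-convergence, with filters in place of
    subsequences. *)
Definition delta_cvg u c := forall U : set_system nat, ProperFilter U ->
  \oo `<=` U -> forall q,
  (asymptotic_radius U u q <= asymptotic_radius U u c)%E -> q = c.

(** N c has at most the asymptotic radius of c, since u is nearly invariant
    under N; uniqueness of the center concludes. *)
Lemma nonexpansive_center_fixed N u U c : ProperFilter U ->
  (forall x y, mdist (N x) (N y) <= mdist x y) ->
  (fun n => mdist (u n) (N (u n))) @ U --> (0 : R) ->
  (asymptotic_radius U u c < +oo)%E ->
  (forall q, (asymptotic_radius U u q <= asymptotic_radius U u c)%E -> q = c) ->
  N c = c.
Proof.
move=> FU Nne uN coo; apply; set r := asymptotic_radius U u c.
have r0 : (0 <= r)%E by exact: asymptotic_radius_ge0.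
have rfin : r \is a fin_num by rewrite ge0_fin_numE.
apply/lee_addgt0Pr => e e0; rewrite -(fineK rfin) -EFinD.
have [||h h0 hP] := @sqr_perturb R (fine r + e / 2) (e / 2).
- by rewrite addr_ge0 ?fine_ge0 ?divr_ge0// ltW.
- by rewrite divr_gt0.
apply: asymptotic_radius_le.
have cn : \forall n \near U, mdist c (u n) ^+ 2 <= fine r + e / 2.
  apply: asymptotic_radius_lt.
  by rewrite -/r -{1}(fineK rfin) lte_fin ltrDl divr_gt0.
have small : \forall n \near U, mdist (u n) (N (u n)) < h.
  exact: (cvgr_lt _ uN _ h0).
apply: filterS2 cn small => n cn nh.
have -> : fine r + e = fine r + e / 2 + e / 2 by lra.
apply: hP cn _; rewrite ?mdist_ge0//.
have := metric_triangle (N c) (N (u n)) (u n); have := Nne c (u n).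
by rewrite (metric_sym (N (u n)) (u n)); lra.
Qed.

(** Asymptotic centers along all filters exist and are fixed points of N.  At a
    fixed point the distances to u converge, so its asymptotic radius does not
    depend on the filter; hence neither does the center. *)
Lemma opial N u : (forall x y, mdist (N x) (N y) <= mdist x y) ->
  (fun n => mdist (u n) (N (u n))) @ \oo --> (0 : R) ->
  (forall p, N p = p -> cvgn (fun n => mdist p (u n) ^+ 2)) ->
  (exists p, N p = p) -> exists2 c, N c = c & delta_cvg u c.
Proof.
move=> Nne uN up [p Np].
have /cvg_ex[l pl] := up _ Np.
have near_p : \forall n \near \oo, mdist p (u n) ^+ 2 <= l + 1.
  have ll1 : l < l + 1 by rewrite ltrDl.
  by apply: filterS (cvgr_lt _ pl _ ll1) => n /ltW.
have center U : ProperFilter U -> \oo `<=` U -> exists2 c, N c = c &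
    forall q, (asymptotic_radius U u q <= asymptotic_radius U u c)%E -> q = c.
  move=> FU Uoo; have [c hc] := asymptotic_center FU (Uoo _ near_p).
  exists c => //; apply: (@nonexpansive_center_fixed N u U) => //.
    by move=> A /uN /Uoo.
  have [cp|/ltW/hc <-] :=
    leP (asymptotic_radius U u c) (asymptotic_radius U u p).
    rewrite (le_lt_trans cp)// (le_lt_trans _ (ltry (l + 1)))//.
    by apply: asymptotic_radius_le; exact: Uoo.
  rewrite (le_lt_trans _ (ltry (l + 1)))//.
  by apply: asymptotic_radius_le; exact: Uoo.
have rad_eq U q : ProperFilter U -> \oo `<=` U -> N q = q ->
    asymptotic_radius U u q = asymptotic_radius \oo u q.
  move=> FU Uoo Nq; have /cvg_ex [r qr] := up _ Nq.
  rewrite (asymptotic_radius_cvg _ qr); apply: asymptotic_radius_cvg.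
  by move=> A /qr /Uoo.
have [c Nc hc] := center \oo _ (fun _ => id).
exists c => // U FU Uoo q; have [d Nd hd] := center U FU Uoo.
suff -> : c = d by exact: hd.
apply: hd; rewrite !rad_eq//.
have [//|dc] := leP (asymptotic_radius \oo u c) (asymptotic_radius \oo u d).
by have e := hc _ (ltW dc); rewrite e ltxx in dc.
Qed.

Lemma geodesic0 x y : geodesic x y 0 = x.
Proof.
apply/esym/mdist_positivity; rewrite mdist_geodesicl ?mul0r//.
by apply/andP; split; lra.
Qed.

(** The distance to a point of the segment is continuous in the parameter, so
    that the minimum defining the projection is attained. *)
Lemma Proj_segment x y z :
  (exists2 l, 0 <= l <= 1 & Proj (segment x y) z = geodesic x y l) /\
  forall l, 0 <= l <= 1 ->
    mdist z (Proj (segment x y) z) <= mdist z (geodesic x y l).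
Proof.
pose f l := mdist z (geodesic x y l).
have fcont : {within `[0, 1], continuous f}.
  apply/subspace_continuousP => l /=; rewrite in_itv /= => l01.
  apply/(@pseudometric_normed_Zmodule.cvgrPdist_lt) => e e0.
  have D0 : 0 < mdist x y + 1 by rewrite ltr_pwDr// mdist_ge0.
  rewrite near_withinE /=.
  have near_l : \forall m \near nbhs l, `|l - m| < e / (mdist x y + 1).
    by apply: (@pseudometric_normed_Zmodule.cvgr_dist_lt _ _ _ _ _ id) => //;
      rewrite divr_gt0.
  apply: filterS near_l => m; rewrite ltr_pdivlMr// in_itv /= => lm m01.
  apply: le_lt_trans (mdist_lipschitz _ _ _) _.
  apply: le_lt_trans (mdist_geodesic _ _ l01 m01) _.
  by apply: le_lt_trans lm; rewrite ler_wpM2l// lerDl.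
have [l] := EVT_min ler01 fcont; rewrite in_itv /= => l01 lmin.
have /(xgetPex point)[] : exists p, segment x y p /\
    forall q, segment x y q -> mdist z p ^+ 2 <= mdist z q ^+ 2.
  exists (geodesic x y l); split; first by exists l; rewrite //= in_itv.
  move=> _ [m /= + <-]; rewrite in_itv /= => m01.
  have := lmin m; rewrite in_itv /= /f => /(_ m01) h.
  by rewrite ler_sqr ?nnegrE ?mdist_ge0.
rewrite -/(Proj (segment x y) z) => -[m /= + mp] pmin.
rewrite in_itv /= => m01; split; first by exists m.
move=> k k01; rewrite -ler_sqr ?nnegrE ?mdist_ge0//; apply: pmin.
by exists k; rewrite //= in_itv.
Qed.

(** If the projections to the segment from c to y stay at distance at least e
    from c along infinitely many n, then for these n the point q of the segment
    at distance e from c lies between c and the projection, hence is no farther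
    from u n than c is.  So q is at least as good a center as c along these n,
    although q differs from c. *)
Lemma delta_cvg_weak u c : delta_cvg u c -> weak_cvg u c.
Proof.
move=> uc y; apply/cvgrPdist_lt => e e0; apply: contrapT => notnear.
pose A := [set n | ~ (mdist c (Proj (segment c y) (u n)) < e)].
have FU : ProperFilter (within A \oo).
  apply: Build_ProperFilter_ex => B BA.
  have {}BA : \forall n \near \oo, A n -> B n by exact: BA.
  apply: contrapT => noB; apply: notnear; apply: filterS BA => n An.
  by apply: contrapT => h; apply: noB; exists n; exact: An.
have near_A : \forall n \near within A \oo, A n by exact: withinT.
have far n : A n -> e <= mdist c (Proj (segment c y) (u n)).
  by move=> /negP; rewrite -leNgt.
have ey : e <= mdist c y.
  have [n An] := filter_ex near_A.
  have [[l l01 lP] _] := Proj_segment c y (u n); have := far n An.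
  rewrite lP mdist_geodesicl// => /le_trans; apply.
  by have /andP[_ l1] := l01; rewrite ler_piMl ?mdist_ge0.
have D0 : 0 < mdist c y by exact: lt_le_trans ey.
have l01 : 0 <= e / mdist c y <= 1.
  by rewrite divr_ge0 ?mdist_ge0 ?(ltW e0)//= ler_pdivrMr// mul1r.
pose q := geodesic c y (e / mdist c y).
have cq : mdist c q = e by rewrite mdist_geodesicl// divfK ?gt_eqF.
suff qc : q = c by move: cq e0; rewrite qc mdistxx => <-; rewrite ltxx.
apply: (uc (within A \oo)).
  exact: (@cvg_within _ \oo _ A).
apply: asymptotic_radius_mono; apply: filterS near_A => n An.
have [[l k01 lP] lmin] := Proj_segment c y (u n).
have := lmin 0; rewrite geodesic0 => /(_ _)/wrap[|uP].
  by apply/andP; split; lra.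
have := far n An; rewrite lP mdist_geodesicl// => el.
have lD0 : 0 < l * mdist c y by exact: lt_le_trans el.
have l0 : 0 < l by rewrite -(pmulr_lgt0 _ D0).
(* The parameter of q on the geodesic from c to the projection. *)
pose m := e / (l * mdist c y).
have m01 : 0 <= m <= 1.
  by rewrite divr_ge0 ?(ltW e0) ?(ltW lD0)//= ler_pdivrMr// mul1r.
have -> : q = geodesic c (geodesic c y l) m.
  rewrite geodesic_geodesic// /q /m; congr geodesic.
  by field; rewrite !gt_eqF.
rewrite -lP -ler_sqr ?nnegrE ?mdist_ge0// !(metric_sym _ (u n)).
have := geodesicP c (Proj (segment c y) (u n)) m01 (u n).
have : mdist (u n) (Proj (segment c y) (u n)) ^+ 2 <= mdist (u n) c ^+ 2.
  by rewrite ler_sqr ?nnegrE ?mdist_ge0.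
have /andP[m0 m1] := m01; have m1' : 0 <= 1 - m by rewrite subr_ge0.
move=> /(ler_wpM2l m0).
have : 0 <= m * (1 - m) * mdist c (Proj (segment c y) (u n)) ^+ 2.
  by apply: mulr_ge0; [exact: mulr_ge0|exact: sqr_ge0].
by lra.
Qed.

End weak_convergence.

(** * Multiplying a function by a positive constant *)

Section scaling.
Context {R : realType} {X : hadamardType R}.
Variables (gam : R) (f : X -> \bar R).
Hypotheses (gam_gt0 : 0 < gam) (f_proper : proper_fun f).

Let F x := (gam%:E * f x)%E.

Lemma scale_fin_num x : (F x \is a fin_num) = (f x \is a fin_num).
Proof.
rewrite /F; case: (f x) => [r||].
- by rewrite -EFinM.
- by rewrite gt0_muley ?lte_fin.
- by rewrite gt0_muleNy ?lte_fin.
Qed.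

Lemma scale_fine x : f x \is a fin_num -> fine (F x) = gam * fine (f x).
Proof. by rewrite /F => fx; rewrite -{1}(fineK fx) -EFinM. Qed.

Lemma scale_proper : proper_fun F.
Proof.
have [[a fa] fN] := f_proper; split.
  exists a; have : F a \is a fin_num.
    by rewrite scale_fin_num; apply: proper_fin_num; rewrite ?ltey.
  by rewrite fin_numE => /andP[].
move=> x; rewrite /F; have := fN x; case: (f x) => [r _||//].
  by rewrite -EFinM.
by rewrite gt0_muley ?lte_fin.
Qed.

(** The absence of the value -oo is what makes multiplication distribute over
    the sum of two possibly infinite terms. *)
Lemma scale_econvex : econvex f -> econvex F.
Proof.
have [_ fN] := f_proper.
move=> fc x y l l01; have /andP[l0 l1] := l01; rewrite /F.
have gtNy (c : R) z : 0 <= c -> (-oo < c%:E * f z)%E.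
  rewrite le_eqVlt => /predU1P[<-|c0]; first by rewrite mul0e ltNyr.
  have := fN z; case: (f z) => [r _||//]; first by rewrite -EFinM ltNyr.
  by rewrite gt0_muley ?lte_fin.
rewrite !(muleCA _ gam%:E) -muleDr//; last first.
  by apply: ltninfty_adde_def; rewrite inE gtNy// subr_ge0.
by rewrite lee_pmul2l// ?lte_fin//; exact: fc.
Qed.

Lemma scale_lsc : lower_semicontinuous f -> lower_semicontinuous F.
Proof.
move=> fl x a; rewrite /F muleC -lte_pdivrMr// -EFinM => /fl[V xV Vf].
by exists V => // y /Vf; rewrite muleC -lte_pdivrMr// -EFinM.
Qed.

End scaling.

(** * Strong convergence under uniform convexity *)

Section uniform_convexity.
Context {R : realType} {X : hadamardType R}.
Implicit Types (F G f : X -> \bar R) (P Q : X -> X) (p q : X) (x y : nat -> X).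

(** The only consequence of uniform convexity that the convergence proof needs:
    a uniform gain at midpoints of points that are far apart. *)
Definition midpoint_gap F := forall t : R, 0 < t -> exists2 c : R, 0 < c &
  forall p q, F p \is a fin_num -> F q \is a fin_num -> t <= mdist p q ->
    fine (F (geodesic p q 2^-1)) <= 2^-1 * fine (F p) + 2^-1 * fine (F q) - c.

Lemma uniformly_convex_gap (gam : R) f : 0 < gam -> proper_fun f ->
  uniformly_convex f -> midpoint_gap (fun z => gam%:E * f z)%E.
Proof.
move=> gam0 fp [phi [phi0 phiS phiE phiP]] t t0.
have : (0 < phi t)%E.
  rewrite lt_neqAle phi0 ?ltW// andbT; apply/negP => /eqP/esym.
  by move=> /(phiE t (ltW t0)).1 te; rewrite te ltxx in t0.
move=> /lte_between[b b0 bphi].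
exists (gam * (4^-1 * b)); first by rewrite !mulr_gt0.
move=> p q; rewrite !scale_fin_num// => fpf fqf tpq.
have lty z : f z \is a fin_num -> (f z < +oo)%E.
  by rewrite fin_numE => /andP[_]; rewrite ltey.
have H := phiP p q _ (@half01 R) (lty _ fpf) (lty _ fqf).
have b_phi : (b%:E <= phi (mdist p q))%E.
  by apply: le_trans (ltW bphi) _; apply: phiS => //; exact: ltW.
have {}H : (f (geodesic p q 2^-1) <=
    (2^-1 * fine (f p) + 2^-1 * fine (f q) - 4^-1 * b)%:E)%E.
  apply: le_trans H _; rewrite -{1}(fineK fpf) -{1}(fineK fqf).
  rewrite -!EFinM -EFinD EFinB; apply: leeB.
    by rewrite lee_fin; lra.
  have -> : (2^-1 * (1 - 2^-1) : R) = 4^-1 by field.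
  by rewrite EFinM lee_pmul2l// lte_fin.
have fm : f (geodesic p q 2^-1) \is a fin_num.
  by apply: proper_fin_num => //; rewrite (le_lt_trans H) ?ltry.
rewrite -(fineK fm) lee_fin in H.
by rewrite !scale_fine//; have := ler_wpM2l (ltW gam0) H; lra.
Qed.

(** If u = P (Q (x n)) is at distance at least t from a, the midpoint between
    (u, Q (x n)) and (a, b) has an energy below the average by a constant;
    minimality of (a, b) then keeps the energy of the round away from its
    limit. *)
Lemma uniformly_convex_alternation_cvg F G P Q x y a b :
  proper_fun F -> proper_fun G -> econvex F -> econvex G -> midpoint_gap F ->
  prox_operator F P -> prox_operator G Q -> inexact_alternation P Q x y ->
  a = P b -> b = Q a -> (fun n => x n.+1) @ \oo --> a /\ y @ \oo --> b.
Proof.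
move=> Fp Gp Fc Gc Fgap PF QG xy aP bQ.
have Fa : F a \is a fin_num by rewrite aP; exact: (PF _).1.
have Gb : G b \is a fin_num by rewrite bQ; exact: (QG _).1.
have [ys xs] := xy.
have y0 := bounded_sums_cvg0 (fun n => mdist_ge0 _ _) ys.
have x0 := bounded_sums_cvg0 (fun n => mdist_ge0 _ _) xs.
have en := alternation_energy_cvg PF QG xy aP bQ.
have near_u t : 0 < t -> \forall n \near \oo, mdist a (P (Q (x n))) < t.
  move=> t0; have [c c0 gap] := Fgap t t0.
  have ec : joint_energy F G a b < joint_energy F G a b + 2 * c.
    by rewrite ltrDl mulr_gt0.
  apply: filterS (cvgr_lt _ en _ ec) => n; apply: contraTT.
  rewrite -!leNgt => far; set u := P _ in far *; set v := Q _.
  have Fu : F u \is a fin_num by exact: (PF _).1.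
  have Gv : G v \is a fin_num by exact: (QG _).1.
  have [Fm _] := econvex_fine Fp Fc (@half01 R) Fa Fu.
  have [Gm gm] := econvex_fine Gp Gc (@half01 R) Gb Gv.
  have := fixed_pair_minimizes PF QG aP bQ Fm Gm.
  have := gap _ _ Fa Fu far; have := sqr_mdist_midpoint_convex a u b v.
  by rewrite /joint_energy; lra.
have xa : (fun n => x n.+1) @ \oo --> a.
  apply/cvgrPdist_lt => e e0; have e3 : 0 < e / 3 by rewrite divr_gt0.
  apply: filterS3 (near_u _ e3) (cvgr_lt _ x0 _ e3) (cvgr_lt _ y0 _ e3).
  move=> n h1 h2 h3.
  have := prox_operator_nonexpansive (y n) (Q (x n)) PF.
  have := metric_triangle a (P (Q (x n))) (x n.+1).
  have := metric_triangle (P (Q (x n))) (P (y n)) (x n.+1).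
  rewrite (metric_sym (P (Q _)) (P (y n))) (metric_sym (P (y n)) (x n.+1)).
  by move: h1 h2 h3 => /=; lra.
have {}xa : x @ \oo --> a by rewrite -cvg_shiftS.
split; first by rewrite cvg_shiftS.
apply/cvgrPdist_lt => e e0; have e2 : 0 < e / 2 by rewrite divr_gt0.
move/cvgrPdist_lt : xa => /(_ _ e2) xa.
apply: filterS2 xa (cvgr_lt _ y0 _ e2) => n /= h1 h2.
have := prox_operator_nonexpansive a (x n) QG; rewrite -bQ.
have := metric_triangle b (Q (x n)) (y n).
by rewrite (metric_sym (Q (x n)) (y n)); lra.
Qed.

End uniform_convexity.

(** * Weak convergence in the product space *)

Section product.
Context {R : realType} {X : hadamardType R}.
Implicit Types (P Q : X -> X) (p q : l2prod X X) (x y : nat -> X).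

Lemma cvg_sqr0 (u : R^nat) : (forall n, 0 <= u n) ->
  (fun n => u n ^+ 2) @ \oo --> (0 : R) -> u @ \oo --> (0 : R).
Proof.
move=> u0 uu; apply/(@pseudometric_normed_Zmodule.cvgrPdist_lt) => e e0.
have e2 : 0 < e ^+ 2 by rewrite exprn_gt0.
apply: filterS (cvgr_lt _ uu _ e2) => n.
by rewrite ltr_sqr ?nnegrE ?(ltW e0)// sub0r normrN ger0_norm.
Qed.

(** A simultaneous rather than successive application of the two proximal maps:
    unlike the successive one, its fixed points are exactly the minimizers. *)
Definition crossed_prox P Q p : l2prod X X := (P p.2, Q p.1).

Lemma crossed_prox_fixed P Q p :
  crossed_prox P Q p = p <-> p.1 = P p.2 /\ p.2 = Q p.1.
Proof.
case: p => a b; rewrite /crossed_prox /=.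
by split=> [[e1 e2]|[e1 e2]]; [rewrite e1 e2|rewrite -e1 -e2].
Qed.

Lemma cvg_l2prod x y (p : l2prod X X) : x @ \oo --> p.1 -> y @ \oo --> p.2 ->
  (fun n => (x n, y n) : l2prod X X) @ \oo --> p.
Proof.
move=> xp yp; apply: cvg_mdist0.
apply: cvg_sqr0 => [n|]; first exact: mdist_ge0.
have -> : (0 : R) =
    mdist p.1 p.1 * mdist p.1 p.1 + mdist p.2 p.2 * mdist p.2 p.2.
  by rewrite !mdistxx; ring.
under eq_fun do rewrite l2distE /= !expr2.
by apply: cvgD; apply: cvgM; exact: cvg_mdist.
Qed.

(** The iterates are nearly fixed by [crossed_prox] because their steps are
    square summable, and their distances to a fixed pair converge in each
    component. *)
Lemma alternation_weak_cvg (F G : X -> \bar R) P Q x y (M : R) a b :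
  prox_operator F P -> prox_operator G Q -> inexact_alternation P Q x y ->
  (forall c d, F c \is a fin_num -> G d \is a fin_num ->
    M <= joint_energy F G c d) ->
  a = P b -> b = Q a ->
  exists2 p : l2prod X X, p.1 = P p.2 /\ p.2 = Q p.1 &
    weak_cvg (fun n => (x n, y n) : l2prod X X) p.
Proof.
move=> PF QG xy FGM aP bQ.
have [||p Np||p Np uc] := @opial _ (l2prod X X) (crossed_prox P Q)
    (fun n => (x n, y n)).
- move=> p q; rewrite -ler_sqr ?nnegrE ?mdist_ge0// !l2distE /= addrC.
  by apply: lerD; rewrite ler_sqr ?nnegrE ?mdist_ge0//;
    [exact: prox_operator_nonexpansive QG|exact: prox_operator_nonexpansive PF].
- apply: cvg_sqr0 => [n|]; first exact: mdist_ge0.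
  apply: bounded_sums_cvg0 => [n|]; first exact: sqr_ge0.
  have [ys xs] := xy.
  have xx := alternation_sqr_steps PF QG xy FGM.
  have ys2 := bounded_sums_sqr (fun n => mdist_ge0 _ _) ys.
  have xs2 := bounded_sums_sqr (fun n => mdist_ge0 _ _) xs.
  apply: bounded_sums_le (bounded_sumsD (bounded_sumsM (ler0n R 2)
    (bounded_sumsD xx xs2)) ys2) => n.
  rewrite l2distE /= lerD2r.
  have := metric_triangle (x n) (x n.+1) (P (y n)).
  rewrite (metric_sym (x n) (x n.+1)).
  have := mdist_ge0 (x n) (P (y n)).
  move: (mdist (x n) (P (y n))) (mdist (x n.+1) (x n)).
  move: (mdist (x n.+1) (P (y n))) => t r s r0 h.
  have : r ^+ 2 <= (s + t) ^+ 2 by rewrite ler_sqr ?nnegrE//; lra.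
  by have := sqr_ge0 (s - t); nra.
- have [p1 p2] := (crossed_prox_fixed P Q p).1 Np.
  have /cvg_ex[l xl] := alternation_cvg_dist PF QG xy p1 p2.
  have /cvg_ex[m ym] :=
    alternation_cvg_dist QG PF (inexact_alternationC xy) p2 p1.
  apply: (cvgP (l * l + m * m)).
  under eq_fun do rewrite metric_sym l2distE /= !expr2.
  by apply: cvgD; apply: cvgM.
- by exists (a, b); apply/crossed_prox_fixed.
exists p; first exact/crossed_prox_fixed.
exact: delta_cvg_weak.
Qed.

End product.

(** * Convergence of the inexact alternating proximal method *)

Section objective_energy.
Context {R : realType} {X : hadamardType R}.
Variables (f g : X -> \bar R) (gam : R).
Hypotheses (f_proper : proper_fun f) (g_proper : proper_fun g).
Hypothesis gam_gt0 : 0 < gam.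
Implicit Types (a b : X) (p : l2prod X X).

Let F z := (gam%:E * f z)%E.
Let G z := (gam%:E * g z)%E.
Let Phi := objective f g gam.

Lemma objectiveE p : F p.1 \is a fin_num -> G p.2 \is a fin_num ->
  Phi p = (gam^-1 * joint_energy F G p.1 p.2)%:E.
Proof.
rewrite !scale_fin_num// => fp gp.
rewrite /Phi /objective /joint_energy !scale_fine// -(fineK fp) -(fineK gp).
rewrite -!EFinD /=; congr EFin; field.
by rewrite gt_eqF.
Qed.

Lemma objective_lty p : (Phi p < +oo)%E ->
  F p.1 \is a fin_num /\ G p.2 \is a fin_num.
Proof.
rewrite !scale_fin_num// /Phi /objective => h.
have [_ fN] := f_proper; have [_ gN] := g_proper.
have := fN p.1; have := gN p.2; move: h.
by case: (f p.1) => [r||]; case: (g p.2) => [s||].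
Qed.

Lemma minimizers_objective_fixed (P Q : X -> X) p :
  prox_operator F P -> prox_operator G Q ->
  minimizers Phi p <-> p.1 = P p.2 /\ p.2 = Q p.1.
Proof.
move=> PF QG.
have dom a b : F (P a) \is a fin_num /\ G (Q b) \is a fin_num.
  by split; [exact: (PF a).1|exact: (QG b).1].
split=> [pmin|[p1 p2] q].
  have [F1 G2] : F p.1 \is a fin_num /\ G p.2 \is a fin_num.
    apply: objective_lty; have [FP GQ] := dom point point.
    apply: le_lt_trans (pmin (P point, Q point)) _.
    by rewrite objectiveE//= ltry.
  have energy_min a b : F a \is a fin_num -> G b \is a fin_num ->
      joint_energy F G p.1 p.2 <= joint_energy F G a b.
    move=> Fa Gb; have := pmin (a, b); rewrite !objectiveE//= lee_fin.
    by rewrite ler_pM2l// invr_gt0.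
  split.
    by apply: (minimizer_eq_prox PF F1 G2) => c Fc; exact: energy_min.
  apply: (minimizer_eq_prox QG G2 F1) => c Gc; rewrite !(joint_energyC F G).
  exact: energy_min.
have [Pp Qp] := dom p.2 p.1; rewrite -p1 -p2 in Pp Qp.
have [/objective_lty[F1 G2]|] := ltP (Phi q) +oo%E; last first.
  by rewrite leye_eq => /eqP ->; exact: leey.
rewrite !objectiveE// lee_fin ler_pM2l ?invr_gt0//.
exact: (fixed_pair_minimizes PF QG p1 p2 F1 G2).
Qed.

End objective_energy.

Theorem theorem1 (R : realType) (X : hadamardType R) (f g : X -> \bar R)
  (gam : R) (x y : nat -> X)
  (f_proper : proper_fun f) (f_convex : econvex f)
  (f_lsc : lower_semicontinuous f)
  (g_proper : proper_fun g) (g_convex : econvex g)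
  (g_lsc : lower_semicontinuous g)
  (gam_gt0 : 0 < gam) :
  let Phi := objective f g gam in
  let Pf := Prox (fun z => gam%:E * f z)%E in
  let Pg := Prox (fun z => gam%:E * g z)%E in
  let xy : nat -> l2prod X X := fun n => (x n, y n) in
  (exists M : R, forall p, (M%:E <= Phi p)%E) ->
  (\sum_(0 <= n <oo) (mdist (y n) (Pg (x n)))%:E < +oo)%E ->
  (\sum_(0 <= n <oo) (mdist (x n.+1) (Pf (y n)))%:E < +oo)%E ->
  [/\ (\sum_(0 <= n <oo) (mdist (x n.+1) (x n) ^+ 2)%:E < +oo)%E,
      (\sum_(0 <= n <oo) (mdist (y n.+1) (y n) ^+ 2)%:E < +oo)%E &
      (exists p, minimizers Phi p) ->
      [/\ (fun n => Phi (Pf (Pg (x n)), Pg (x n))) @ \oo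
            --> ereal_inf (range Phi) /\
          (fun n => Phi (Pf (y n), Pg (Pf (y n)))) @ \oo
            --> ereal_inf (range Phi),
          exists2 p : l2prod X X, minimizers Phi p & weak_cvg xy p &
          uniformly_convex f \/ uniformly_convex g ->
          exists2 p : l2prod X X, minimizers Phi = [set p] & xy @ \oo --> p]].
Proof.
move=> Phi Pf Pg xy [M PhiM] ys xs.
pose F z := (gam%:E * f z)%E; pose G z := (gam%:E * g z)%E.
have Fp : proper_fun F by exact: scale_proper.
have Gp : proper_fun G by exact: scale_proper.
have Fc : econvex F by exact: scale_econvex.
have Gc : econvex G by exact: scale_econvex.
have energyM a b : F a \is a fin_num -> G b \is a fin_num ->
    gam * M <= joint_energy F G a b.
  move=> Fa Gb; have := PhiM (a, b); rewrite /Phi objectiveE// lee_fin /=.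
  by rewrite mulrC ler_pdivlMr// mulrC.
have energyMC b a : G b \is a fin_num -> F a \is a fin_num ->
    gam * M <= joint_energy G F b a.
  by move=> Gb Fa; rewrite joint_energyC; exact: energyM.
have dom H : proper_fun H -> exists a : X, H a \is a fin_num.
  move=> Hp; have [[a Ha] _] := Hp.
  by exists a; apply: proper_fin_num; rewrite ?ltey.
have PF : prox_operator F Pf.
  have [b Gb] := dom _ Gp.
  apply: (@Prox_operator _ _ _ Fp Fc (scale_lsc gam_gt0 f_lsc) b
    (gam * M - fine (G b))) => a Fa.
  by have := energyM a b Fa Gb; rewrite /joint_energy (metric_sym a b); lra.
have QG : prox_operator G Pg.
  have [a Fa] := dom _ Fp.
  apply: (@Prox_operator _ _ _ Gp Gc (scale_lsc gam_gt0 g_lsc) a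
    (gam * M - fine (F a))) => b Gb.
  by have := energyM a b Fa Gb; rewrite /joint_energy; lra.
have alt : inexact_alternation Pf Pg x y.
  by split; apply/nneseries_lty_bounded_sums => // n; exact: mdist_ge0.
have altC := inexact_alternationC alt.
split.
- apply/nneseries_lty_bounded_sums => [n|]; first exact: sqr_ge0.
  exact: (alternation_sqr_steps PF QG alt energyM).
- apply/nneseries_lty_bounded_sums => [n|]; first exact: sqr_ge0.
  exact: (alternation_sqr_steps QG PF altC energyMC).
have minE p := minimizers_objective_fixed f_proper g_proper gam_gt0 p PF QG.
move=> [p pmin]; have [p1 p2] := (minE p).1 pmin.
have Fp1 : F p.1 \is a fin_num by rewrite p1; exact: (PF _).1.
have Gp2 : G p.2 \is a fin_num by rewrite p2; exact: (QG _).1.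
have infE : ereal_inf (range Phi) = (gam^-1 * joint_energy F G p.1 p.2)%:E.
  rewrite -objectiveE//; apply/eqP; rewrite eq_le; apply/andP; split.
    by apply: ereal_inf_lbound; exists p.
  by apply: le_ereal_inf_tmp => _ [q _ <-]; exact: pmin.
split.
- have scaled_cvg (u : R^nat) (r : R) : u @ \oo --> r ->
      (fun n => (gam^-1 * u n)%:E) @ \oo --> (gam^-1 * r)%:E.
    move=> ur; apply: cvg_EFin; first exact: nearW.
    have {}ur : (fun n => gam^-1 * u n) @ \oo --> gam^-1 * r by apply: cvgMr.
    exact: ur.
  rewrite infE; split.
    under eq_fun do rewrite /Phi objectiveE// ?(PF _).1 ?(QG _).1//.
    apply: scaled_cvg; exact: (alternation_energy_cvg PF QG alt p1 p2).
  under eq_fun do rewrite /Phi objectiveE// ?(PF _).1 ?(QG _).1//=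
    -(joint_energyC F G).
  rewrite -(joint_energyC F G).
  apply: scaled_cvg; exact: (alternation_energy_cvg QG PF altC p2 p1).
- have [q qfix xyq] := alternation_weak_cvg PF QG alt energyM p1 p2.
  by exists q => //; apply/minE.
move=> unif.
have xyq q : minimizers Phi q -> xy @ \oo --> q.
  move=> /(minE q).1[q1 q2].
  case: unif => [/(uniformly_convex_gap gam_gt0 f_proper) Fgap
                |/(uniformly_convex_gap gam_gt0 g_proper) Ggap].
    have [xq yq] := uniformly_convex_alternation_cvg Fp Gp Fc Gc Fgap PF QG alt
      q1 q2.
    by apply: (@cvg_l2prod _ _ x y q) => //; rewrite -cvg_shiftS.
  have [yq xq] := uniformly_convex_alternation_cvg Gp Fp Gc Fc Ggap QG PF altC
    q2 q1.
  by apply: (@cvg_l2prod _ _ x y q) => //; rewrite -cvg_shiftS.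
exists p; last exact: xyq.
apply/seteqP; split=> [q qmin|_ -> //].
exact: (cvg_unique (@metric_hausdorff R (l2prod X X))
  (xyq _ qmin) (xyq _ pmin)).
Qed.
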